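(* Let $\Lambda\subset\mathbb{R}^N$ be a non-periodic Delone set. Then the following are equivalent: (i) $\Lambda$ is linearly repetitive (LR); (ii) $\Lambda$ satisfies (PQ) and (U); (iii) $\Lambda$ satisfies (PW) and (U).
   Context: Let $\varrho$ be the Euclidean distance, $B_R(p)$ the closed ball, $B_R=B_R(0)$, $|\cdot|$ Lebesgue measure on $\mathbb{R}^N$. For a set $\Gamma$, $r_{pack}(\Gamma)=\inf\{\tfrac12\varrho(x,y):x\ne y\in\Gamma\}$ and $r_{cov}(\Gamma)=\sup_{p\in\mathbb{R}^N}\varrho(p,\Gamma)$; $\Gamma$ is Delone if $r_{pack}>0$ and $r_{cov}<\infty$. $\Lambda$ is non-periodic if $\Lambda-x\ne\Lambda$ for all $x\ne0$. A ball pattern is $P=(x,R)\in\Lambda\times(0,\infty)$, $r(P)=R$; locater set $L_P=\{y\in\Lambda:(\Lambda-y)\cap B_R=(\Lambda-x)\cap B_R\}$. For bounded $Q$: $L_P(Q)=\{y\in L_P:B_R(y)\subset Q\}$, $\sharp_PQ=\sharp L_P(Q)$, $\sharp'_PQ$ = maximal cardinality of $A\subset L_P(Q)$ with $\varrho(y,z)>2R$ for distinct $y,z\in A$. With $C$ ranging over cubes in $\mathbb{R}^N$: $\nu(P)=\liminf_{|C|\to\infty}\sharp_PC\,|B_R|/|C|$, $\nu'(P)=\liminf_{|C|\to\infty}\sharp'_PC\,|B_R|/|C|$. (PW): $\inf\{\nu(P):r(P)\ge1\}>0$. (PQ): $\inf\{\nu'(P):r(P)\ge1\}>0$. (LR):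 $\sup\{r_{cov}(L_P)/r(P): r(P)\ge1\}<\infty$ (this presupposes $L_P$ relatively dense). For a discrete set $\Gamma$ with at least two points and $x\in\Gamma$, the Voronoi cell is $V_x(\Gamma)=\{p:\varrho(p,x)\le\varrho(p,y)\ \forall y\in\Gamma\}$; $r_{in}(V_x)=\varrho(x,\partial V_x)$, $r_{out}(V_x)=\sup_{y\in\partial V_x}\varrho(x,y)$, distortion $\lambda(V_x)=r_{out}/r_{in}$, and $\lambda(\Gamma)=\sup_{x\in\Gamma}\lambda(V_x(\Gamma))$. (U): $\Lambda$ is repetitive (every $L_P$ relatively dense) and $\sup_P\lambda(L_P)<\infty$ over all ball patterns $P$. *)

(* Defs.v *)
(* R^N is 'rV[R]_N.  The norm and the balls that the library
   puts on 'rV[R]_N are those of the sup norm, so the Euclidean distance and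
   balls are defined here; the topology (used for the boundary of a Voronoi
   cell) is the library's, the two norms being equivalent.
   Infima and suprema are taken in \bar R, hence inf set0 = +oo. *)
From mathcomp Require Import all_boot all_order all_algebra.
From mathcomp Require Import all_classical all_reals all_analysis.

Set Implicit Arguments.
Unset Strict Implicit.
Unset Printing Implicit Defensive.

Import Order.TTheory GRing.Theory Num.Theory.
Import numFieldNormedType.Exports.

Local Open Scope classical_set_scope.
Local Open Scope ring_scope.

Section Space.
Context {R : realType} {N : nat}.
Local Notation E := 'rV[R]_N.

Definition eucl_dist (x y : E) : R :=
  Num.sqrt (\sum_(i < N) (x 0 i - y 0 i) ^+ 2).

Definition eucl_dist_set (p : E) (A : set E) : \bar R :=
  ereal_inf [set (eucl_dist p y)%:E | y in A].

Definition eucl_ball (p : E) (r : R) : set E := [set y | eucl_dist p y <= r].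

Definition boundary (A : set E) : set E := closure A `\` interior A.

Definition open_box (b : E * E) : set E :=
  [set x | forall i, b.1 0 i < x 0 i < b.2 0 i].

Definition box_vol (b : E * E) : R := \prod_(i < N) (b.2 0 i - b.1 0 i).

Definition box_covers (A : set E) : set (nat -> E * E) :=
  [set b : nat -> E * E | (forall k (i : 'I_N), (b k).1 0 i <= (b k).2 0 i) /\
           A `<=` \bigcup_k open_box (b k)].

(* Lebesgue outer measure; on Lebesgue measurable sets, in particular on balls
   and cubes, it is the Lebesgue measure of R^N. *)
Definition leb_vol (A : set E) : \bar R :=
  ereal_inf [set (\sum_(k <oo) (box_vol (b k))%:E)%E | b in box_covers A].

(* c.1 is the corner with minimal coordinates, c.2 the side length. *)
Definition cube (c : E * R) : set E :=
  [set x | forall i, c.1 0 i <= x 0 i <= c.1 0 i + c.2].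

(* The filter of "|C| -> oo" on nondegenerate cubes C. *)
Definition large_cubes : set_system (E * R)%type :=
  filter_from [set: R] (fun M => [set c | 0 < c.2 /\ (M%:E < leb_vol (cube c))%E]).

Definition translate_by (G : set E) (x : E) : set E := [set y - x | y in G].

Definition r_pack (G : set E) : \bar R :=
  ereal_inf [set (eucl_dist z.1 z.2 / 2)%:E |
             z in [set z : E * E | [/\ G z.1, G z.2 & z.1 <> z.2]]].

Definition r_cov (G : set E) : \bar R :=
  ereal_sup [set eucl_dist_set p G | p in [set: E]].

Definition relatively_dense (G : set E) : Prop := (r_cov G < +oo)%E.

Definition delone (G : set E) : Prop :=
  (0 < r_pack G)%E /\ relatively_dense G.

Definition nonperiodic (G : set E) : Prop :=
  forall x : E, x != 0 -> translate_by G x <> G.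

Definition voronoi (G : set E) (x : E) : set E :=
  [set p | forall y, G y -> eucl_dist p x <= eucl_dist p y].

Definition voronoi_in (G : set E) (x : E) : \bar R :=
  eucl_dist_set x (boundary (voronoi G x)).

Definition voronoi_out (G : set E) (x : E) : \bar R :=
  ereal_sup [set (eucl_dist x y)%:E | y in boundary (voronoi G x)].

Definition cell_distortion (G : set E) (x : E) : \bar R :=
  (voronoi_out G x / voronoi_in G x)%E.

Definition distortion (G : set E) : \bar R :=
  ereal_sup [set cell_distortion G x | x in G].

End Space.

Section Patterns.
Context {R : realType} {N : nat}.
Local Notation E := 'rV[R]_N.
Variable Lam : set E.

(* The ball patterns (x, r) of Lam. *)
Definition ball_patterns : set (E * R) := [set P | Lam P.1 /\ 0 < P.2].

Definition ball_patterns_ge1 : set (E * R) :=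
  [set P | ball_patterns P /\ 1 <= P.2].

Definition locator (P : E * R) : set E :=
  [set y | Lam y /\ translate_by Lam y `&` eucl_ball 0 P.2 =
                    translate_by Lam P.1 `&` eucl_ball 0 P.2].

Definition locator_in (P : E * R) (Q : set E) : set E :=
  [set y | locator P y /\ eucl_ball y P.2 `<=` Q].

(* The values of npat and npat' are natural numbers when Lam is Delone and Q
   is bounded; the supremum in npat' is then a maximum. *)
Definition npat (P : E * R) (Q : set E) : \bar R := counting (locator_in P Q).

Definition npat' (P : E * R) (Q : set E) : \bar R :=
  ereal_sup [set counting A | A in
    [set A : set E | A `<=` locator_in P Q /\
      forall y z, A y -> A z -> y <> z -> 2 * P.2 < eucl_dist y z]].

Definition nu (P : E * R) : \bar R :=
  limf_einf (fun c : E * R =>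
    npat P (cube c) * leb_vol (eucl_ball (0 : E) P.2)
      / leb_vol (cube c))%E large_cubes.

Definition nu' (P : E * R) : \bar R :=
  limf_einf (fun c : E * R =>
    npat' P (cube c) * leb_vol (eucl_ball (0 : E) P.2)
      / leb_vol (cube c))%E large_cubes.

Definition positive_weights : Prop :=
  (0 < ereal_inf [set nu P | P in ball_patterns_ge1])%E.

Definition positive_quasiweights : Prop :=
  (0 < ereal_inf [set nu' P | P in ball_patterns_ge1])%E.

Definition linearly_repetitive : Prop :=
  (ereal_sup [set r_cov (locator P) / P.2%:E | P in ball_patterns_ge1]
     < +oo)%E.

Definition repetitive : Prop :=
  forall P, ball_patterns P -> relatively_dense (locator P).

Definition uniform_cells : Prop :=
  repetitive /\
  (ereal_sup [set distortion (locator P) | P in ball_patterns] < +oo)%E.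

End Patterns.

(* Main.v *)
(* A linearly repetitive non-periodic set satisfies r_pack(L_P) >= c r(P): a
   short vector v joining two occurrences of a large patch would, by linear
   repetitivity, be a period of Lam.  So the Voronoi cells of L_P have inner and
   outer radii comparable to r(P), and one occurrence of P near the centre of
   each cell of a grid of mesh comparable to r(P) gives (PQ).

   Conversely assume (PW) and (U).  By (PW), two occurrences of P lie within
   a_0 = C r(P) of each other.  By (U), neighbouring Voronoi cells of L_P have
   comparable sizes; so if L_P has a hole of size a_K = l^K a_0, then for every
   k < K some y_k in L_P has its nearest neighbour in L_P at a distance between
   a_k and a_(k+1).  The patterns Q_k = (y_k, r(P) + a_(k+1)) see this distance,
   so balls of radius a_k / 2 around the points of L_(Q_k) are disjoint for all
   k, while by (PW) those of each k fill a fixed proportion of space.  This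
   bounds K. *)
Require Import Defs.
From mathcomp Require Import all_boot all_order all_algebra.
From mathcomp Require Import all_classical all_reals all_analysis.
From mathcomp Require Import measurable_realfun ring lra.

Set Implicit Arguments.
Unset Strict Implicit.
Unset Printing Implicit Defensive.

Import Order.TTheory GRing.Theory Num.Theory.
Import numFieldNormedType.Exports.

Local Open Scope classical_set_scope.
Local Open Scope ring_scope.

(** * Volume of boxes *)

Section Volume.
Context {R : realType}.

(** Monotone convergence allows integration term by term; this serves to integrate out one
    coordinate of a series of weighted box indicators. *)
Lemma integral_eseries_itv (w a b : nat -> R) :
  (forall k, 0 <= w k) -> (forall k, a k <= b k) ->
  (\int[lebesgue_measure]_(y in [set: R])
     (\sum_(k <oo) (w k * \1_(`]a k, b k[%classic : set R) y)%:E) =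
   \sum_(k <oo) (w k * (b k - a k))%:E)%E.
Proof.
move=> w0 ab; rewrite integral_nneseries //; last 2 first.
- move=> k; apply/measurable_EFinP; apply: measurable_funM => //.
- by move=> k y _; rewrite lee_fin mulr_ge0.
apply: eq_eseriesr => k _.
under eq_integral do rewrite EFinM.
rewrite ge0_integralZl_EFin //; last first.
  by apply/measurable_EFinP; exact: measurable_indic.
rewrite integral_indic // setIT.
rewrite [X in (_ * X)%E](lebesgue_measure_itv `]a k, b k[) /= lte_fin EFinM.
by case: ltgtP (ab k) => // ->; rewrite subrr.
Qed.

(* Comparing both sides one coordinate at a time is Tonelli's theorem for
   step functions. *)
Lemma le_weighted_boxes n (u v : nat -> R) (a b a' b' : nat -> nat -> R) :
  (forall k, 0 <= u k) -> (forall k, 0 <= v k) ->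
  (forall k i, a k i <= b k i) -> (forall k i, a' k i <= b' k i) ->
  (forall x : nat -> R,
    (\sum_(k <oo) (u k * \prod_(i < n) \1_(`]a k i, b k i[%classic : set R) (x i))%:E <=
     \sum_(k <oo) (v k * \prod_(i < n) \1_(`]a' k i, b' k i[%classic : set R) (x i))%:E)%E) ->
  (\sum_(k <oo) (u k * \prod_(i < n) (b k i - a k i))%:E <=
   \sum_(k <oo) (v k * \prod_(i < n) (b' k i - a' k i))%:E)%E.
Proof.
elim: n u v => [|n IH] u v u0 v0 ab ab' uv.
  have := uv (fun=> 0).
  by under eq_eseriesr do rewrite big_ord0; under [leRHS]eq_eseriesr do rewrite big_ord0;
     under [X in _ -> (X <= _)%E]eq_eseriesr do rewrite big_ord0;
     under [X in _ -> (_ <= X)%E]eq_eseriesr do rewrite big_ord0.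
(* With the last coordinate frozen at [y], its indicator is absorbed into the weights and the
   induction hypothesis applies. Integrating over [y] then restores the last side length. *)
have slice (y : R) :
  (\sum_(k <oo) ((u k * \prod_(i < n) (b k i - a k i)) *
      \1_(`]a k n, b k n[%classic : set R) y)%:E <=
   \sum_(k <oo) ((v k * \prod_(i < n) (b' k i - a' k i)) *
      \1_(`]a' k n, b' k n[%classic : set R) y)%:E)%E.
  have := IH (fun k => u k * \1_(`]a k n, b k n[%classic : set R) y)
             (fun k => v k * \1_(`]a' k n, b' k n[%classic : set R) y).
  under eq_eseriesr do rewrite mulrAC.
  under [X in _ -> (_ <= X)%E]eq_eseriesr do rewrite mulrAC.
  apply => //; try by move=> k; rewrite mulr_ge0.
  move=> x; have := uv (fun i => if i == n then y else x i).
  have E (w : nat -> R) (c d : nat -> nat -> R) :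
    (\sum_(k <oo) (w k * \prod_(i < n.+1) \1_(`]c k i, d k i[%classic : set R)
                    (if i == n :> nat then y else x i))%:E =
     \sum_(k <oo) (w k * \1_(`]c k n, d k n[%classic : set R) y *
        \prod_(i < n) \1_(`]c k i, d k i[%classic : set R) (x i))%:E)%E.
    apply: eq_eseriesr => k _; rewrite big_ord_recr /= eqxx -mulrA.
    congr (_ * _)%:E; rewrite mulrC; congr (_ * _).
    by apply: eq_bigr => i _; rewrite ltn_eqF.
  by rewrite !E.
have E (w : nat -> R) (c d : nat -> nat -> R) :
    (forall k, 0 <= w k) -> (forall k i, c k i <= d k i) ->
    (\sum_(k <oo) (w k * \prod_(i < n.+1) (d k i - c k i))%:E =
    \int[lebesgue_measure]_(y in [set: R]) (\sum_(k <oo)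
      ((w k * \prod_(i < n) (d k i - c k i)) *
       \1_(`]c k n, d k n[%classic : set R) y)%:E))%E.
  move=> w0 cd; rewrite integral_eseries_itv //; last first.
    by move=> k; rewrite mulr_ge0 // prodr_ge0 // => i _; rewrite subr_ge0.
  by apply: eq_eseriesr => k _; rewrite big_ord_recr /= mulrA.
rewrite !E //; apply: ge0_le_integral => //.
- move=> y _; apply: nneseries_ge0 => k _ _.
  rewrite lee_fin !mulr_ge0 // prodr_ge0 // => i _; by rewrite subr_ge0.
- apply: ge0_emeasurable_sum => [k y _ _|k _].
    rewrite lee_fin !mulr_ge0 // prodr_ge0 // => i _; by rewrite subr_ge0.
  by apply/measurable_EFinP; apply: measurable_funM => //; exact: measurable_indic.
- apply: ge0_emeasurable_sum => [k y _ _|k _].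
    rewrite lee_fin !mulr_ge0 // prodr_ge0 // => i _; by rewrite subr_ge0.
  by apply/measurable_EFinP; apply: measurable_funM => //; exact: measurable_indic.
Qed.

(** Only the indexing changes. Reading coordinates through [inord] needs a positive dimension; in
    dimension 0 every box is the whole one-point space and has volume 1. *)
Lemma le_weighted_open_boxes N (u v : nat -> R)
    (B B' : nat -> 'rV[R]_N * 'rV[R]_N) :
  (forall k, 0 <= u k) -> (forall k, 0 <= v k) ->
  (forall k i, (B k).1 0 i <= (B k).2 0 i) ->
  (forall k i, (B' k).1 0 i <= (B' k).2 0 i) ->
  (forall x : 'rV[R]_N,
    (\sum_(k <oo) (u k * \1_(open_box (B k)) x)%:E <=
     \sum_(k <oo) (v k * \1_(open_box (B' k)) x)%:E)%E) ->
  (\sum_(k <oo) (u k * box_vol (B k))%:E <=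
   \sum_(k <oo) (v k * box_vol (B' k))%:E)%E.
Proof.
case: N B B' => [|n] B B' u0 v0 BB BB' uv.
  have E (w : nat -> R) (C : nat -> 'rV[R]_0 * 'rV[R]_0) :
    (\sum_(k <oo) (w k * box_vol (C k))%:E =
     \sum_(k <oo) (w k * \1_(open_box (C k)) (0 : 'rV[R]_0))%:E)%E.
    apply: eq_eseriesr => k _; congr (_ * _)%:E.
    by rewrite /box_vol big_ord0 indicE mem_set // => -[].
  by rewrite !E.
have E (w : nat -> R) (C : nat -> 'rV[R]_n.+1 * 'rV[R]_n.+1) :
    (\sum_(k <oo) (w k * box_vol (C k))%:E =
     \sum_(k <oo) (w k * \prod_(i < n.+1)
       ((C k).2 0 (inord i) - (C k).1 0 (inord i)))%:E)%E.
  apply: eq_eseriesr => k _; congr (_ * _)%:E.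
  by apply: eq_bigr => i _; rewrite inord_val.
rewrite !E; apply: (le_weighted_boxes (a := fun k i => (B k).1 0 (inord i))
  (b := fun k i => (B k).2 0 (inord i)) (a' := fun k i => (B' k).1 0 (inord i))
  (b' := fun k i => (B' k).2 0 (inord i))) => // x.
have E2 (w : nat -> R) (C : nat -> 'rV[R]_n.+1 * 'rV[R]_n.+1) :
  (\sum_(k <oo) (w k * \prod_(i < n.+1)
     \1_(`](C k).1 0 (inord i), (C k).2 0 (inord i)[%classic : set R) (x i))%:E =
   \sum_(k <oo) (w k * \1_(open_box (C k)) (\row_(i < n.+1) x i))%:E)%E.
  apply: eq_eseriesr => k _; congr (_ * _)%:E.
  rewrite indicE.
  have [xC|xC] := pselect (open_box (C k) (\row_(i < n.+1) x i)).
    rewrite mem_set //.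
    rewrite big1 // => i _; rewrite indicE mem_set //=.
    by have := xC i; rewrite inord_val mxE in_itv.
  have /existsNP[i xi] := xC; rewrite [in RHS]memNset // (bigD1 i) //= indicE memNset ?mul0r //=.
  by rewrite in_itv /= inord_val => h; apply: xi; rewrite mxE.
by rewrite !E2; exact: uv.
Qed.

Lemma nneseries_finite_support (u : nat -> \bar R) m :
  (forall k, (0 <= u k)%E) -> (forall k, (m <= k)%N -> u k = 0%E) ->
  (\sum_(k <oo) u k = \sum_(k < m) u k)%E.
Proof.
move=> u0 um; rewrite (nneseries_split _ m) // add0n eseries0 ?adde0.
  by rewrite big_mkord.
by move=> k mk _; exact: um.
Qed.


(** This is the hard half of the volume computation: a countable cover of [A] dominates the
    indicator of [b] pointwise, hence also its volume. *)
Lemma leb_vol_ge N (A : set 'rV[R]_N) (b : 'rV[R]_N * 'rV[R]_N) :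
  (forall i, b.1 0 i <= b.2 0 i) -> open_box b `<=` A ->
  ((box_vol b)%:E <= leb_vol A)%E.
Proof.
move=> bb bA; apply: le_ereal_inf_tmp => _ [B [BB AB] <-].
(* The weights [(k == 0)%:R] make the constant sequence [b] count once. *)
have H := @le_weighted_open_boxes N (fun k => (k == 0)%:R) (fun=> 1) (fun=> b) B.
have E (f : nat -> R) : (forall k, 0 <= f k) ->
    (\sum_(k <oo) ((k == 0)%:R * f k)%:E = (f 0%N)%:E)%E.
  move=> f0; rewrite (@nneseries_finite_support _ 1) ?big_ord1 ?mul1r //.
    by move=> k; rewrite lee_fin mulr_ge0.
  by case=> // k _; rewrite mul0r.
rewrite E in H; last by move=> k; rewrite prodr_ge0 // => i _; rewrite subr_ge0.
have E1 (f : nat -> R) : (\sum_(k <oo) (1 * f k)%:E = \sum_(k <oo) (f k)%:E)%E.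
  by apply: eq_eseriesr => k _; rewrite mul1r.
rewrite E1 in H; apply: H => //.
move=> x; rewrite E // E1.
have [xb|xb] := pselect (open_box b x); last first.
  rewrite indicE memNset //; by apply: nneseries_ge0 => k _ _; rewrite lee_fin.
have [k _ xk] := AB _ (bA _ xb).
rewrite (nneseries_split 0 k.+1) //.
rewrite add0n big_nat_recr //=.
have -> : \1_(open_box (B k)) x = 1 :> R by rewrite indicE mem_set.
have -> : \1_(open_box b) x = 1 :> R by rewrite indicE mem_set.
rewrite addeAC leeDr // adde_ge0 //.
  by apply: sume_ge0.
by apply: nneseries_ge0.
Qed.

Lemma leb_vol_le N (A : set 'rV[R]_N) (b : 'rV[R]_N * 'rV[R]_N) : (0 < N)%N ->
  (forall i, b.1 0 i <= b.2 0 i) -> A `<=` open_box b ->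
  (leb_vol A <= (box_vol b)%:E)%E.
Proof.
move=> N0 bb Ab; apply: ereal_inf_lbound.
(* All further boxes are degenerate; their volume is 0 because the product of sides is nonempty when
   [0 < N]. *)
exists (fun k => if k == 0%N then b else (0, 0)).
  split=> [[|k] i //=|x /Ab xb].
  by exists 0%N.
rewrite (@nneseries_finite_support _ 1) ?big_ord1 // => [k|[|k] //= _].
  rewrite lee_fin prodr_ge0 // => i _; rewrite subr_ge0.
  by case: k => //=.
by rewrite /box_vol /= (bigD1 (Ordinal N0)) //= subrr mul0r.
Qed.

End Volume.

(** * Euclidean distance and packings *)

Section Euclid.
Context {R : realType} {N : nat}.
Local Notation E := 'rV[R]_N.
Implicit Types x y z u v : E.

Lemma eucl_dist_ge0 x y : 0 <= eucl_dist x y.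
Proof. exact: sqrtr_ge0. Qed.

Lemma eucl_distxx x : eucl_dist x x = 0.
Proof.
by rewrite /eucl_dist big1 ?sqrtr0 // => i _; rewrite subrr expr0n.
Qed.

Lemma eucl_distC x y : eucl_dist x y = eucl_dist y x.
Proof.
congr Num.sqrt; apply: eq_bigr => i _.
by rewrite -sqrrN opprB.
Qed.

Lemma eucl_distDr x y z : eucl_dist (x + z) (y + z) = eucl_dist x y.
Proof.
congr Num.sqrt; apply: eq_bigr => i _; rewrite !mxE; congr (_ ^+ 2).
by ring.
Qed.

Lemma eucl_dist_sub0 x y : eucl_dist 0 (x - y) = eucl_dist y x.
Proof. by rewrite -(eucl_distDr y x (- y)) subrr. Qed.

Lemma eucl_dist_sqr x y : eucl_dist x y ^+ 2 = \sum_(i < N) (x 0 i - y 0 i) ^+ 2.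
Proof. by rewrite sqr_sqrtr // sumr_ge0 // => i _; exact: sqr_ge0. Qed.

Lemma eucl_dist_coord x y i : `|x 0 i - y 0 i| <= eucl_dist x y.
Proof.
rewrite -(@ler_pXn2r _ 2) ?nnegrE ?eucl_dist_ge0 // eucl_dist_sqr real_normK ?num_real //.
by rewrite (bigD1 i) //= lerDl sumr_ge0 // => j _; exact: sqr_ge0.
Qed.

Lemma eucl_dist_eq0 x y : eucl_dist x y = 0 -> x = y.
Proof.
move=> xy; apply/rowP => i; apply/eqP; rewrite -subr_eq0 -normr_le0 -xy.
exact: eucl_dist_coord.
Qed.

Lemma eucl_dist_gt0 x y : x <> y -> 0 < eucl_dist x y.
Proof.
by move=> xy; rewrite lt0r eucl_dist_ge0 andbT; apply/eqP => /eucl_dist_eq0.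
Qed.

(** With [A], [B], [C] for the three sums, [B * (A * B - C ^+ 2)] is the sum of the squares of
    [B * a i - C * b i]. Either [B] can be cancelled or all [b i] vanish. *)
Lemma sum_cauchy_schwarz (a b : 'I_N -> R) :
  (\sum_i a i * b i) ^+ 2 <= (\sum_i a i ^+ 2) * (\sum_i b i ^+ 2).
Proof.
set A := \sum_i a i ^+ 2; set B := \sum_i b i ^+ 2; set C := \sum_i _.
have B0 : 0 <= B by rewrite sumr_ge0 // => i _; exact: sqr_ge0.
have H : 0 <= B * (A * B - C ^+ 2).
  have -> : B * (A * B - C ^+ 2) = \sum_i (B * a i - C * b i) ^+ 2.
    under eq_bigr do rewrite sqrrB !exprMn.
    rewrite big_split /= sumrB -!mulr_sumr -/A -/B.
    have -> : \sum_(i < N) B * a i * (C * b i) *+ 2 = B * C * C *+ 2.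
      rewrite sumrMnl; congr (_ *+ 2); rewrite -[X in _ = _ * X]/(\sum_i a i * b i) mulr_sumr.
      by apply: eq_bigr => i _; ring.
    by ring.
  by rewrite sumr_ge0 // => i _; exact: sqr_ge0.
have [B_gt0|] := ltP 0 B; first by move: H; rewrite pmulr_rge0 // subr_ge0.
move=> B_le0; have {B_le0} B_eq0 : B = 0 by apply/le_anti; rewrite B_le0.
rewrite B_eq0 mulr0 [C]big1 ?expr0n // => i _.
move/eqP: B_eq0; rewrite psumr_eq0; last by move=> j _; exact: sqr_ge0.
by move=> /allP/(_ i); rewrite mem_index_enum sqrf_eq0 => /(_ isT)/eqP ->; rewrite mulr0.
Qed.

Lemma eucl_dist_triangle y x z : eucl_dist x z <= eucl_dist x y + eucl_dist y z.
Proof.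
rewrite -(@ler_pXn2r _ 2) ?nnegrE ?addr_ge0 ?eucl_dist_ge0 // sqrrD !eucl_dist_sqr.
have CS := @sum_cauchy_schwarz (fun i => x 0 i - y 0 i) (fun i => y 0 i - z 0 i).
have -> : \sum_i (x 0 i - z 0 i) ^+ 2 = \sum_i (x 0 i - y 0 i) ^+ 2 +
   (\sum_i (x 0 i - y 0 i) * (y 0 i - z 0 i)) *+ 2 + \sum_i (y 0 i - z 0 i) ^+ 2.
  rewrite -sumrMnl -!big_split /=; apply: eq_bigr => i _; by ring.
rewrite lerD2r lerD2l lerMn2r /=; apply: le_trans (ler_norm _) _.
rewrite -(@ler_pXn2r _ 2) ?nnegrE ?mulr_ge0 ?eucl_dist_ge0 //.
by rewrite exprMn !eucl_dist_sqr real_normK ?num_real.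
Qed.

(** Dividing by [N] instead of its square root is wasteful but keeps roots out of all later
    constants. *)
Lemma eucl_dist_le_coord x y (r : R) : (0 < N)%N -> 
  (forall i, `|x 0 i - y 0 i| <= r / N%:R) -> eucl_dist x y <= r.
Proof.
move=> N0 H; have NR : 1 <= N%:R :> R by rewrite ler1n.
have r0 : 0 <= r.
  have := le_trans (normr_ge0 _) (H (Ordinal N0)).
  by rewrite ler_pdivlMr ?mul0r // (lt_le_trans ltr01).
rewrite -(@ler_pXn2r _ 2) ?nnegrE ?eucl_dist_ge0 // eucl_dist_sqr.
apply: (@le_trans _ _ (\sum_(i < N) (r / N%:R) ^+ 2)).
  apply: ler_sum => i _; rewrite -[leLHS]real_normK ?num_real //.
  by rewrite ler_pXn2r // nnegrE divr_ge0.
rewrite sumr_const card_ord -(mulr_natr ((r / N%:R) ^+ 2)) expr_div_n -mulrA ler_piMr ?sqr_ge0 //.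
rewrite expr2 invfM -mulrA mulVf ?mulr1 ?gt_eqF ?(lt_le_trans ltr01) //.
by rewrite invf_le1 // (lt_le_trans ltr01).
Qed.

Lemma eucl_dist_lt_coord x y (r : R) : (0 < N)%N ->
  (forall i, `|x 0 i - y 0 i| < r / N%:R) -> eucl_dist x y < r.
Proof.
move=> N0 H; have NR : 0 < N%:R :> R by rewrite ltr0n.
pose m := \big[Num.max/0]_(i < N) `|x 0 i - y 0 i|.
have m_lt : m < r / N%:R.
  apply: bigmax_lt => //.
  exact: le_lt_trans (normr_ge0 _) (H (Ordinal N0)).
apply: (@le_lt_trans _ _ (m * N%:R)); last by rewrite -ltr_pdivlMr.
apply: eucl_dist_le_coord => // i; rewrite mulfK ?gt_eqF //.
exact: le_bigmax.
Qed.

Definition open_cube y (h : R) : E * E := (y - const_mx h, y + const_mx h).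

Lemma open_cubeP y h x :
  open_box (open_cube y h) x <-> forall i, `|x 0 i - y 0 i| < h.
Proof.
by split=> H i; have := H i; rewrite /= !mxE ltr_norml; lra.
Qed.

Lemma box_vol_open_cube y h : box_vol (open_cube y h) = (2 * h) ^+ N.
Proof.
rewrite /box_vol (eq_bigr (fun=> 2 * h)) ?prodr_const ?card_ord // => i _.
by rewrite !mxE; ring.
Qed.

Lemma open_cube_le y h i : 0 <= h -> (open_cube y h).1 0 i <= (open_cube y h).2 0 i.
Proof. by move=> h0; rewrite !mxE; lra. Qed.

(** Volumes of cubes and balls matter only up to constant factors, so here and in the next three
    lemmas crude inscribed and circumscribed open cubes suffice. *)
Lemma leb_vol_cube_ge (c : E * R) : 0 <= c.2 -> ((c.2 ^+ N)%:E <= leb_vol (cube c))%E.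
Proof.
move=> s0; have -> : c.2 ^+ N = box_vol (open_cube (c.1 + const_mx (c.2 / 2)) (c.2 / 2)).
  by rewrite box_vol_open_cube; congr (_ ^+ _); lra.
apply: leb_vol_ge => [i|x /open_cubeP H i]; first by apply: open_cube_le; lra.
by have := H i; rewrite !mxE ltr_norml; lra.
Qed.

Lemma leb_vol_cube_le (c : E * R) : (0 < N)%N -> 0 < c.2 ->
  (leb_vol (cube c) <= ((3 * c.2) ^+ N)%:E)%E.
Proof.
move=> N0 s0; have -> : 3 * c.2 = 2 * (3 / 2 * c.2) by lra.
rewrite -(box_vol_open_cube (c.1 + const_mx (c.2 / 2))).
apply: leb_vol_le => // [i|x H]; first by apply: open_cube_le; lra.
by apply/open_cubeP => i; have := H i; rewrite !mxE ltr_norml; lra.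
Qed.

Lemma leb_vol_ball_ge y (r : R) : (0 < N)%N -> 0 <= r ->
  (((2 * (r / N%:R)) ^+ N)%:E <= leb_vol (eucl_ball y r))%E.
Proof.
move=> N0 r0; rewrite -(box_vol_open_cube y).
apply: leb_vol_ge => [i|x /open_cubeP H]; first by rewrite open_cube_le // divr_ge0.
by rewrite /eucl_ball /= eucl_distC ltW // eucl_dist_lt_coord.
Qed.

Lemma leb_vol_ball_le y (r : R) : (0 < N)%N -> 0 < r ->
  (leb_vol (eucl_ball y r) <= ((4 * r) ^+ N)%:E)%E.
Proof.
move=> N0 r0; have -> : 4 * r = 2 * (2 * r) by lra.
rewrite -(box_vol_open_cube y).
apply: leb_vol_le => // [i|x H]; first by rewrite open_cube_le //; lra.
apply/open_cubeP => i; rewrite distrC.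
by apply: le_lt_trans (eucl_dist_coord _ _ i) _; apply: le_lt_trans H _; lra.
Qed.

(** The balls of radius [r j / 2] about the [z j] are disjoint. Each contains the open cube of half
    side [r j / N%:R / 2], and all these cubes lie in the cube concentric with [c] of three times
    its side. *)
Lemma packing_bound m (z : 'I_m -> E) (r : 'I_m -> R) (c : E * R) :
  (0 < N)%N -> 0 <= c.2 -> (forall j, 0 < r j <= c.2) -> (forall j, cube c (z j)) ->
  (forall j k, j != k -> r j + r k <= 2 * eucl_dist (z j) (z k)) ->
  \sum_j (r j / N%:R) ^+ N <= (3 * c.2) ^+ N.
Proof.
move=> N0 c0 r0 zc sep; have NR : 1 <= N%:R :> R by rewrite ler1n.
have N1 : 0 < N%:R :> R by rewrite ltr0n.
pose B0 := open_cube (c.1 + const_mx (c.2 / 2)) (3 / 2 * c.2).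
(* Beyond [m] the boxes are dummies, and the weight [(k < m)%N%:R] discards them. *)
pose B (k : nat) : E * E := if insub k is Some j then open_cube (z j) (r j / N%:R / 2) else (0, 0).
have H := @le_weighted_open_boxes R N (fun k => (k < m)%N%:R) (fun k => (k == 0)%:R)
  B (fun=> B0).
have Bj (j : 'I_m) : B j = open_cube (z j) (r j / N%:R / 2) by rewrite /B valK.
have E1 (f : nat -> R) : (forall k, 0 <= f k) ->
    (\sum_(k <oo) ((k < m)%N%:R * f k)%:E = (\sum_(j < m) f j)%:E)%E.
  move=> f0; rewrite (@nneseries_finite_support _ _ m).
  - by rewrite -sumEFin; apply: eq_bigr => j _; rewrite ltn_ord mul1r.
  - by move=> k; rewrite lee_fin mulr_ge0.
  - by move=> k mk; rewrite ltnNge mk mul0r.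
have E0 (f : nat -> R) : (forall k, 0 <= f k) ->
    (\sum_(k <oo) ((k == 0)%:R * f k)%:E = (f 0%N)%:E)%E.
  move=> f0; rewrite (@nneseries_finite_support _ _ 1) ?big_ord1 ?mul1r //.
    by move=> k; rewrite lee_fin mulr_ge0.
  by case=> // k _; rewrite mul0r.
have BB k i : (B k).1 0 i <= (B k).2 0 i.
  rewrite /B; case: insubP => //= j _ _; rewrite open_cube_le //.
  by rewrite !divr_ge0 //; have := r0 j; lra.
have BB0 i : B0.1 0 i <= B0.2 0 i by rewrite open_cube_le //; lra.
have vol0 (b : E * E) : (forall i, b.1 0 i <= b.2 0 i) -> 0 <= box_vol b.
  by move=> bb; rewrite prodr_ge0 // => i _; rewrite subr_ge0.
rewrite E1 in H; last by move=> k; exact: vol0.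
rewrite E0 in H; last by move=> k; exact: vol0.
have -> : (3 * c.2) = 2 * (3 / 2 * c.2) by lra.
rewrite -(box_vol_open_cube (c.1 + const_mx (c.2 / 2))) -/B0.
have -> : \sum_j (r j / N%:R) ^+ N = \sum_(j < m) box_vol (B j).
  by apply: eq_bigr => j _; rewrite Bj box_vol_open_cube; congr (_ ^+ _); lra.
rewrite -lee_fin; apply: H => // x.
rewrite E1 // E0 // lee_fin.
have [[j xj]|nx] := pselect (exists j : 'I_m, open_box (B j) x); last first.
  rewrite big1 ?indicE // => j _; rewrite indicE memNset // => xj.
  by apply: nx; exists j.
rewrite (bigD1 j) //= big1 => [|k kj].
  rewrite !indicE mem_set // addr0 mem_set //; apply/open_cubeP => i.
  move: xj; rewrite Bj => /open_cubeP/(_ i); have := zc j i; have /andP[rj rc] := r0 j.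
  have : r j / N%:R <= r j by rewrite ler_pdivrMr // ler_peMr // ltW.
  by rewrite !mxE !ltr_norml; lra.
rewrite indicE memNset // => xk.
have dj (l : 'I_m) : open_box (B l) x -> eucl_dist x (z l) < r l / 2.
  rewrite Bj => /open_cubeP xl; apply: eucl_dist_lt_coord => // i.
  by have := xl i; rewrite mulrAC.
have := sep _ _ kj; have := dj _ xj; have := dj _ xk.
have := eucl_dist_triangle x (z k) (z j); rewrite (eucl_distC (z k) x); lra.
Qed.

End Euclid.

(** * Voronoi cells *)

Section Voronoi.
Context {R : realType} {N : nat}.
Local Notation E := 'rV[R]_N.
Implicit Types (x y z p : E) (G : set E) (d A l : R).

(** This and [covering] are real-valued stand-ins for bounds on [r_pack] and [r_cov]; [d] bounds
    twice the packing radius from below. *)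
Definition separated_by G d := forall y z, G y -> G z -> y <> z -> d <= eucl_dist y z.

Definition covering G A := forall p, exists2 y, G y & eucl_dist p y <= A.

Lemma eucl_dist_ray y v (s t : R) :
  eucl_dist (y + s *: v) (y + t *: v) = `|s - t| * eucl_dist 0 v.
Proof.
apply/eqP; rewrite -(@eqrXn2 _ 2) ?mulr_ge0 ?eucl_dist_ge0 //.
rewrite exprMn !eucl_dist_sqr real_normK ?num_real // mulr_sumr.
by apply/eqP/eq_bigr => i _; rewrite !mxE; ring.
Qed.

Lemma near_eucl_dist_lt x (e : R) : (0 < N)%N -> 0 < e ->
  \forall y \near x, eucl_dist x y < e.
Proof.
move=> N0 e0; apply/nbhs_ballP; exists (e / N%:R) => [|y xy] /=.
  by rewrite divr_gt0 // ltr0n.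
by apply: eucl_dist_lt_coord => // i; exact: (xy.2 0 i).
Qed.

(** If no point were nearest, one could always move strictly closer to [p]. This yields arbitrarily
    many points of [G], mutually at distance at least [d], in one cube about [p], against the
    packing bound. *)
Lemma nearest_point G d p : (0 < N)%N -> 0 < d -> separated_by G d -> G !=set0 ->
  exists y, G y /\ forall z, G z -> eucl_dist p y <= eucl_dist p z.
Proof.
move=> N0 d0 sepG [y0 Gy0]; apply: contrapT => none.
have closer y : exists z, G y -> G z /\ eucl_dist p z < eucl_dist p y.
  have [Gy|] := pselect (G y); last by exists y.
  apply: contrapT => nz; apply: none; exists y; split=> // z Gz.
  by rewrite leNgt; apply/negP => zy; apply: nz; exists z.
have [f fP] := choice closer.
pose z n := iter n f y0.
have Gz n : G (z n) by elim: n => [//|n /fP[]].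
have z_lt m n : (m < n)%N -> eucl_dist p (z n) < eucl_dist p (z m).
  elim: n => // n IH; rewrite ltnS leq_eqVlt => /predU1P[->|/IH].
    by have [] := fP _ (Gz n).
  by apply: lt_trans; have [] := fP _ (Gz n).
have z_le n : eucl_dist p (z n) <= eucl_dist p y0.
  by case: n => // n; exact/ltW/(z_lt 0%N).
set D := eucl_dist p y0; have D0 : 0 <= D by exact: eucl_dist_ge0.
have bound m : m%:R * (d / N%:R) ^+ N <= (3 * (2 * (D + d))) ^+ N.
  have := @packing_bound R N m (fun j => z j) (fun=> d) (p - const_mx (D + d), 2 * (D + d)).
  rewrite sumr_const card_ord -(mulr_natl ((d / N%:R) ^+ N)); apply => //=.
  - by lra.
  - by move=> _; lra.
  - move=> j i; have := le_trans (eucl_dist_coord p (z j) i) (z_le j).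
    by rewrite /= !mxE ler_norml -/D; lra.
  - move=> j k jk; have : z j <> z k; last by move=> /(sepG _ _ (Gz j) (Gz k)); lra.
    move=> zjk; have := jk; rewrite neq_ltn => /orP[] /z_lt; by rewrite zjk ltxx.
have dN : 0 < (d / N%:R) ^+ N by rewrite exprn_gt0 // divr_gt0 // ltr0n.
pose q := (3 * (2 * (D + d))) ^+ N / (d / N%:R) ^+ N.
have := bound (Num.Def.archi_bound q); rewrite -ler_pdivlMr // -/q leNgt archi_boundP //.
by rewrite divr_ge0 ?exprn_ge0 ?divr_ge0 //; lra.
Qed.

(** The supremum of the parameters at which the ray is in [V] gives the point: it is a limit of
    points of [V], and no neighbourhood of it stays in [V]. *)
Lemma boundary_on_ray (V : set E) y v (t0 t1 : R) :
  V (y + t0 *: v) -> (forall t, V (y + t *: v) -> t <= t1) ->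
  exists2 t, t0 <= t <= t1 & boundary V (y + t *: v).
Proof.
move=> Vt0 ub; pose S : set R := [set t | V (y + t *: v)].
have supS : has_sup S by split; [exists t0|exists t1].
have cont (t : R) : (fun s : R => y + s *: v) @ t --> y + t *: v.
  by apply: cvgD; [exact: cvg_cst|apply: cvgZl; exact: cvg_id].
exists (sup S).
  by rewrite (ub_le_sup _ Vt0) ?ge_sup //; [exists t0|exact: supS.2].
split=> [B /cont /nbhs_ballP[e /= e0 eB]|/cont /nbhs_ballP[e /= e0 eV]].
  have [t St tS] := sup_adherent e0 supS.
  exists (y + t *: v); split=> //; apply: eB.
  have := ub_le_sup supS.2 St; rewrite /ball /= ltr_norml; lra.
have : S (sup S + e / 2).
  by apply: eV; rewrite /ball /= ltr_norml; lra.
by move=> /(ub_le_sup supS.2); lra.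
Qed.

(** By the triangle inequality, a point at distance less than [d / 2] from [y] is interior to the
    cell, hence not on its boundary. *)
Lemma voronoi_in_ge G d y : (0 < N)%N -> separated_by G d -> G y ->
  ((d / 2)%:E <= voronoi_in G y)%E.
Proof.
move=> N0 sepG Gy; apply: le_ereal_inf_tmp => _ [p [_ pV] <-].
rewrite lee_fin leNgt; apply/negP => yp; apply: pV.
have := @near_eucl_dist_lt p (d / 2 - eucl_dist y p) N0.
rewrite subr_gt0 => /(_ yp); apply: filterS => q pq z Gz.
have [->|/eqP yz] := eqVneq y z; first exact: lexx.
have := sepG _ _ Gy Gz yz; have := eucl_dist_triangle p y q.
have := eucl_dist_triangle q y z; rewrite (eucl_distC q y); lra.
Qed.

Lemma voronoi_out_le G A y : (0 < N)%N -> covering G A ->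
  (voronoi_out G y <= A%:E)%E.
Proof.
move=> N0 covG; apply: ge_ereal_sup => _ [p [pV _] <-].
rewrite lee_fin; apply/ler_addgt0Pr => e e0.
have [q [Vq pq]] := pV _ (near_eucl_dist_lt p N0 e0).
have [z Gz qz] := covG q.
have := eucl_dist_triangle q y p; have := Vq z Gz.
by rewrite (eucl_distC q y) (eucl_distC q p); lra.
Qed.

Lemma distortion_le G d A : (0 < N)%N -> 0 < d -> 0 <= A ->
  separated_by G d -> covering G A -> (distortion G <= (A / (d / 2))%:E)%E.
Proof.
move=> N0 d0 A0 sepG covG; apply: ge_ereal_sup => _ [y Gy <-].
have := voronoi_in_ge N0 sepG Gy; have := voronoi_out_le y N0 covG.
rewrite /cell_distortion.
case: (voronoi_in G y) => [i||] //; case: (voronoi_out G y) => [u||] //.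
- rewrite !lee_fin => uA di; rewrite inver gt_eqF ?lee_fin; last by lra.
  have d2 : 0 < d / 2 by lra.
  apply: (@le_trans _ _ (A / i)).
    by rewrite ler_wpM2r // invr_ge0; lra.
  by rewrite ler_wpM2l // lef_pV2 // posrE; lra.
(* The infinite values left come from an empty boundary; the inverse of [+oo] is 0. *)
- move=> _; rewrite lee_fin => di; rewrite inver gt_eqF; last by lra.
  by rewrite gt0_mulNye ?leNye // lte_fin invr_gt0; lra.
- by move=> _ _; rewrite /inve mule0 lee_fin divr_ge0 //; lra.
- by move=> _ _; rewrite /inve mule0 lee_fin divr_ge0 //; lra.
Qed.

(** The ray from [y] to [z] leaves the cell no later than the midpoint, so the inner radius is at
    most half of [eucl_dist y z]. The ray from [y] through [p] leaves it no earlier than [p], so the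
    outer radius is at least [eucl_dist p y]. *)
Lemma voronoi_dist_le G d A l y z p : (0 < N)%N -> 0 < d -> 0 <= l ->
  separated_by G d -> covering G A -> (distortion G <= l%:E)%E ->
  G y -> G z -> y <> z -> voronoi G y p ->
  eucl_dist p y <= l * (eucl_dist y z / 2).
Proof.
move=> N0 d0 l0 sepG covG dist Gy Gz yz Vp.
have [->|/eqP py] := eqVneq p y.
  by rewrite eucl_distxx mulr_ge0 ?divr_ge0 ?eucl_dist_ge0.
have yz0 := eucl_dist_gt0 yz; have py0 := eucl_dist_gt0 py.
have ray (v : E) t : eucl_dist (y + t *: v) y = `|t| * eucl_dist 0 v.
  by have := eucl_dist_ray y v t 0; rewrite scale0r addr0 subr0.
have in_le : (voronoi_in G y <= (eucl_dist y z / 2)%:E)%E.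
  have [t t_le bt] : exists2 t, 0 <= t <= 1 / 2 & boundary (voronoi G y) (y + t *: (z - y)).
    apply: boundary_on_ray => [w Gw|t /(_ z Gz)].
      by rewrite scale0r addr0 eucl_distxx eucl_dist_ge0.
    have H := eucl_dist_ray y (z - y) t 1; rewrite scale1r subrKC in H; rewrite ray H.
    rewrite ler_pM2r ?eucl_dist_sub0 // => t1; have := ler_norm t; move: t1.
    by case: (ler0P (t - 1)); lra.
  apply: le_trans (ereal_inf_lbound _) _; first by exists (y + t *: (z - y)).
  rewrite lee_fin eucl_distC ray eucl_dist_sub0 mulrC ger0_norm; last by lra.
  by rewrite ler_pM2l; lra.
have out_ge : ((eucl_dist p y)%:E <= voronoi_out G y)%E.
  (* The covering radius bounds the cell, so the ray does leave it. *)
  have [t t_ge bt] : exists2 t, 1 <= t <= A / eucl_dist y p &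
      boundary (voronoi G y) (y + t *: (p - y)).
    apply: boundary_on_ray => [|t Vt]; first by rewrite scale1r subrKC.
    have [w Gw wA] := covG (y + t *: (p - y)).
    rewrite ler_pdivlMr 1?eucl_distC //.
    have := Vt w Gw; rewrite ray eucl_dist_sub0 => tw.
    rewrite eucl_distC; apply: le_trans (le_trans tw wA).
    by rewrite eucl_distC ler_wpM2r ?eucl_dist_ge0 // ler_norm.
  apply: le_trans (ereal_sup_ubound _); last by exists (y + t *: (p - y)).
  rewrite lee_fin eucl_distC [leRHS]eucl_distC ray eucl_dist_sub0.
  by rewrite ler_peMl ?eucl_dist_ge0 // ger0_norm; lra.
have in_ge := voronoi_in_ge N0 sepG Gy.
have out_le := voronoi_out_le y N0 covG.
have := le_trans (ereal_sup_ubound _) dist; move/(_ (cell_distortion G y)).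
move=> /(_ (ex_intro2 _ _ y Gy erefl)); rewrite /cell_distortion.
case: (voronoi_in G y) in_ge in_le => [i||] //; case: (voronoi_out G y) out_ge out_le => [u||] //.
rewrite !lee_fin => pu uA di iz; rewrite inver gt_eqF ?lee_fin; last by lra.
rewrite ler_pdivrMr; last by lra.
by move=> uli; apply: le_trans pu (le_trans uli _); rewrite ler_wpM2l.
Qed.

(** On a segment from a point of [X] to one of [Y], the distance to [X] minus the distance to [Y]
    changes sign. At a zero, nearest points in [X] and in [Y] are equally far; they may coincide. *)
Lemma voronoi_common_point (X Y : set E) d : (0 < N)%N -> 0 < d ->
  separated_by (X `|` Y) d -> X !=set0 -> Y !=set0 ->
  exists p, exists x, exists y, [/\ X x, Y y, eucl_dist p x = eucl_dist p y &
    voronoi (X `|` Y) x p].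
Proof.
move=> N0 d0 sep [x0 Xx0] [y0 Yy0].
have sepX : separated_by X d by move=> *; apply: sep => //; left.
have sepY : separated_by Y d by move=> *; apply: sep => //; right.
have [f fP] := choice (fun p => @nearest_point X d p N0 d0 sepX (ex_intro _ _ Xx0)).
have [g gP] := choice (fun p => @nearest_point Y d p N0 d0 sepY (ex_intro _ _ Yy0)).
pose q (t : R) := x0 + t *: (y0 - x0).
pose F t := eucl_dist (q t) (f (q t)); pose G t := eucl_dist (q t) (g (q t)).
set L := eucl_dist 0 (y0 - x0); have L0 : 0 <= L by exact: eucl_dist_ge0.
have qq s t : eucl_dist (q s) (q t) = `|s - t| * L by exact: eucl_dist_ray.
have lipF s t : F s <= F t + `|s - t| * L.
  apply: le_trans ((fP (q s)).2 _ (fP (q t)).1) _.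
  by have := eucl_dist_triangle (q t) (q s) (f (q t)); rewrite qq -/(F t); lra.
have lipG s t : G s <= G t + `|s - t| * L.
  apply: le_trans ((gP (q s)).2 _ (gP (q t)).1) _.
  by have := eucl_dist_triangle (q t) (q s) (g (q t)); rewrite qq -/(G t); lra.
have cont : continuous (fun t => F t - G t).
  move=> t; apply/cvgrPdist_lt => e e0; near=> s.
  (* Both distances are [L]-Lipschitz, so their difference is [2 * L]-Lipschitz; the added 1 avoids
     a zero denominator. *)
  have : `|t - s| < e / (2 * L + 1).
    near: s; apply/nbhs_ballP; exists (e / (2 * L + 1)) => //=.
    by rewrite divr_gt0 //; lra.
  rewrite ltr_pdivlMr; last by lra.
  have := lipF s t; have := lipF t s; have := lipG s t; have := lipG t s.
  rewrite (distrC s t); set m := `|t - s| => h1 h2 h3 h4 h5.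
  have m0 : 0 <= m by exact: normr_ge0.
  rewrite ltr_norml; apply/andP; split; nra.
have q0 : q 0 = x0 by rewrite /q scale0r addr0.
have q1 : q 1 = y0 by rewrite /q scale1r subrKC.
have F0 : F 0 - G 0 <= 0.
  have := (fP x0).2 _ Xx0; rewrite /F /G q0 eucl_distxx.
  have := eucl_dist_ge0 x0 (g x0); lra.
have F1 : 0 <= F 1 - G 1.
  have := (gP y0).2 _ Yy0; rewrite /F /G q1 eucl_distxx.
  have := eucl_dist_ge0 y0 (f y0); lra.
have [] := @IVT R (fun t => F t - G t) 0 1 0 ler01.
- exact: continuous_subspaceT.
- by rewrite ge_min F0 /= le_max F1 orbT.
move=> t _ /eqP; rewrite subr_eq0 => /eqP FG.
exists (q t), (f (q t)), (g (q t)); split=> //.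
- exact: (fP _).1.
- exact: (gP _).1.
- move=> z [Xz|Yz]; first exact: (fP _).2.
  by rewrite -/(F t) FG; exact: (gP _).2.
Unshelve. all: by end_near.
Qed.

End Voronoi.

(** * Linear repetitivity and repulsion *)

Section Covering.
Context {R : realType} {N : nat}.
Local Notation E := 'rV[R]_N.
Implicit Types (x y z p : E) (G : set E) (d A l : R).

(** Strictness of the bound makes up for an infimum that need not be attained. *)
Lemma covering_of_r_cov G A : (r_cov G < A%:E)%E -> covering G A.
Proof.
move=> GA p; have : (eucl_dist_set p G < A%:E)%E.
  by apply: le_lt_trans GA; apply: ereal_sup_ubound; exists p.
move=> /ereal_inf_lt[_ [y Gy <-]]; rewrite lte_fin => /ltW pA; by exists y.
Qed.

Lemma r_cov_le G A : covering G A -> (r_cov G <= A%:E)%E.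
Proof.
move=> covG; apply: ge_ereal_sup => _ [p _ <-]; have [y Gy yA] := covG p.
apply: (@le_trans _ _ (eucl_dist p y)%:E); last by rewrite lee_fin.
by apply: ereal_inf_lbound; exists y.
Qed.

Lemma relatively_dense_covering G : relatively_dense G -> exists A, covering G A.
Proof.
rewrite /relatively_dense; case E : (r_cov G) => [a||] // _.
- by exists (a + 1); apply: covering_of_r_cov; rewrite E lte_fin ltrDl.
- by exists 0; apply: covering_of_r_cov; rewrite E ltNyr.
Qed.

Lemma r_pack_separated G : (0 < r_pack G)%E -> exists2 d : R, 0 < d & separated_by G d.
Proof.
move=> pG; have [e e0 eG] : exists2 e : R, 0 < e & (e%:E <= r_pack G)%E.
  case: (r_pack G) pG => [e||] //; first by rewrite lte_fin => e0; exists e.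
  by move=> _; exists 1; rewrite ?leey.
exists e => // y z Gy Gz yz.
have : (r_pack G <= (eucl_dist y z / 2)%:E)%E.
  by apply: ereal_inf_lbound; exists (y, z).
move=> /(le_trans eG); rewrite lee_fin; lra.
Qed.

Lemma inve_gt0_fin (r : R) : 0 < r -> (r%:E^-1 = (r^-1)%:E)%E.
Proof. by move=> r0; rewrite inver gt_eqF. Qed.

Lemma translate_byE G x y : translate_by G x y = G (y + x).
Proof.
rewrite propeqE; split=> [[z Gz <-]|Gyx]; first by rewrite subrK.
by exists (y + x); rewrite ?addrK.
Qed.

End Covering.

Section LinearRepetitivity.
Context {R : realType} {N : nat}.
Local Notation E := 'rV[R]_N.
Variable Lam : set E.
Implicit Types (P : E * R) (x y z p v : E) (d A l k : R).

Lemma locatorP P y : locator Lam P y <->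
  Lam y /\ forall v, eucl_dist 0 v <= P.2 -> Lam (v + y) <-> Lam (v + P.1).
Proof.
split=> -[Ly H]; split=> //.
  by move=> v vP; move/seteqP: H => [H1 H2]; rewrite -!translate_byE; split=> L;
     [have [] := H1 v (conj L vP)|have [] := H2 v (conj L vP)].
by apply/seteqP; split=> v; rewrite /setI /= !translate_byE => -[L vP]; split=> //;
   apply/(H v vP).
Qed.

Lemma locator_sub P : locator Lam P `<=` Lam.
Proof. by move=> y /locatorP[]. Qed.

Lemma locator_agree P y z v : locator Lam P y -> locator Lam P z ->
  eucl_dist 0 v <= P.2 -> Lam (v + y) <-> Lam (v + z).
Proof.
by move=> /locatorP[_ Hy] /locatorP[_ Hz] vP; rewrite (Hy v vP) (Hz v vP).
Qed.

Lemma locator_le x (r s : R) : r <= s -> locator Lam (x, s) `<=` locator Lam (x, r).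
Proof.
move=> rs y /locatorP[Ly H]; apply/locatorP; split=> // v vr.
by apply: H; exact: le_trans rs.
Qed.

Definition linear_covering k :=
  forall P, ball_patterns_ge1 Lam P -> covering (locator Lam P) (k * P.2).

Lemma linearly_repetitive_covering : linearly_repetitive Lam ->
  exists2 k : R, 0 < k & linear_covering k.
Proof.
rewrite /linearly_repetitive; set s := ereal_sup _ => s_fin.
have [k k0 sk] : exists2 k : R, 0 <= k & (s <= k%:E)%E.
  case: s s_fin => [a||] // _; last by exists 0; rewrite ?leNye.
  by exists `|a|; rewrite // lee_fin ler_norm.
(* The added 1 makes the bound on [r_cov] strict and the constant positive. *)
exists (k + 1) => [|P P1]; first lra.
have R0 := P1.1.2; apply: covering_of_r_cov.
have : (r_cov (locator Lam P) / P.2%:E <= k%:E)%E.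
  by apply: le_trans sk; apply: ereal_sup_ubound; exists P.
rewrite inve_gt0_fin // lee_pdivrMr // => /le_lt_trans; apply.
by rewrite -EFinM lte_fin; nra.
Qed.

Lemma covering_linearly_repetitive k : linear_covering k -> linearly_repetitive Lam.
Proof.
move=> cov; apply: (@le_lt_trans _ _ k%:E); last exact: ltry.
apply: ge_ereal_sup => _ [P P1 <-]; have R0 := P1.1.2; rewrite inve_gt0_fin // lee_pdivrMr //.
by rewrite -EFinM; apply: r_cov_le; exact: cov.
Qed.

(* A copy of the s-patch of q within k * s of y carries q + (z - y) to a point
   of Lam, because the patches of Lam at y and z agree up to radius P.2. *)
Lemma local_period_global k P y z q (s : R) : linear_covering k ->
  locator Lam P y -> locator Lam P z -> 1 <= s -> k * s <= P.2 ->
  eucl_dist y z <= s -> Lam q -> Lam (q + (z - y)).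
Proof.
move=> cov Py Pz s1 sP yzs Lq.
have P1 : ball_patterns_ge1 Lam (q, s) by split=> //; split=> //=; lra.
have [u /locatorP[/= Lu qu] yu] := cov _ P1 y.
rewrite addrC; apply/qu; first by rewrite eucl_dist_sub0.
have := locator_agree Py Pz (v := u - y); rewrite subrK eucl_dist_sub0.
move=> /(_ (le_trans yu sP)) [/(_ Lu) Luz _].
have -> : z - y + u = u - y + z by rewrite addrC addrA addrAC.
exact: Luz.
Qed.

(** Two occurrences [y], [z] closer than this would make [z - y] a period of [Lam]:
    [local_period_global] gives one inclusion, and the other with [y] and [z] exchanged. *)
Lemma locator_separated k d P : 0 < k -> linear_covering k -> nonperiodic Lam ->
  0 < d -> separated_by Lam d -> ball_patterns_ge1 Lam P ->
  separated_by (locator Lam P) (Num.min 1 d / (k + 1) * P.2).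
Proof.
move=> k0 cov nonper d0 sepL [[_ R0] R1] y z Py Pz yz.
have k1 : 0 < k + 1 by lra.
set c := Num.min 1 d.
have c1 : c <= 1 by rewrite /c ge_min lexx.
have cd : c <= d by rewrite /c ge_min lexx orbT.
have c0 : 0 < c by rewrite /c lt_min ltr01.
have dyz := sepL _ _ (locator_sub Py) (locator_sub Pz) yz.
rewrite mulrAC ler_pdivrMr //.
(* For small radii the separation of [Lam] itself is enough, since [c <= d]. *)
have [Rk|Rk] := leP P.2 (k + 1).
  by apply: (@le_trans _ _ (d * (k + 1))); [nra|rewrite ler_wpM2r // ltW].
rewrite leNgt; apply/negP => close.
(* At this scale every [s]-patch recurs within [k * s], inside the region where the patches at [y]
   and [z] agree; [c <= 1] puts [z] within [s] of [y]. *)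
pose s := P.2 / (k + 1).
have s1 : 1 <= s by rewrite ler_pdivlMr // mul1r ltW.
have sP : k * s <= P.2 by rewrite mulrA ler_pdivrMr //; nra.
have yzs : eucl_dist y z <= s by rewrite ler_pdivlMr //; nra.
have zy0 : z - y != 0 by rewrite subr_eq0; apply/eqP => zy; exact: yz.
apply: (nonper _ zy0); apply/seteqP; split=> q; rewrite translate_byE => Lq.
  have := local_period_global cov Pz Py s1 sP _ Lq; rewrite eucl_distC => /(_ yzs).
  by rewrite -addrA subrKA subrr addr0.
exact: (local_period_global cov Py Pz s1 sP yzs Lq).
Qed.

Lemma linearly_repetitive_uniform_cells : (0 < N)%N -> delone Lam ->
  nonperiodic Lam -> linearly_repetitive Lam -> uniform_cells Lam.
Proof.
move=> N0 [/r_pack_separated[d d0 sepL] _] nonper.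
move=> /linearly_repetitive_covering[k k0 cov].
set c := Num.min 1 d / (k + 1).
have c0 : 0 < c by rewrite divr_gt0 ?lt_min ?ltr01 //; lra.
(* (LR) speaks only of radii at least 1. For a smaller radius, the locator set contains that of the
   pattern with the same centre and radius 1. *)
have cov1 P : ball_patterns Lam P -> P.2 < 1 -> covering (locator Lam P) k.
  case: P => x r [Lx r0] /ltW r1 p.
  have P1 : ball_patterns_ge1 Lam (x, 1) by split=> //; split=> //=.
  have [y xy py] := cov _ P1 p.
  by exists y; [exact: locator_le xy|rewrite mulr1 in py].
split.
  move=> P P0; have [P1|P1] := leP 1 P.2.
    by apply: le_lt_trans (r_cov_le (cov P _)) (ltry _).
  by apply: le_lt_trans (r_cov_le (cov1 P P0 P1)) (ltry _).
apply: (@le_lt_trans _ _ (k / (c / 2) + k / (d / 2))%:E); last exact: ltry.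
have kc : 0 <= k / (c / 2) by rewrite divr_ge0 //; lra.
have kd : 0 <= k / (d / 2) by rewrite divr_ge0 //; lra.
apply: ge_ereal_sup => _ [P P0 <-]; have [P1|P1] := leP 1 P.2.
  have R0 := P0.2.
  apply: (@le_trans _ _ (k * P.2 / (c * P.2 / 2))%:E).
    apply: distortion_le => //; first by rewrite mulr_gt0.
    - by rewrite mulr_ge0 // ltW.
    - by apply: locator_separated.
    - by apply: cov.
  rewrite lee_fin.
  have -> : k * P.2 / (c * P.2 / 2) = k / (c / 2) by field; rewrite !gt_eqF.
  by rewrite lerDl.
apply: (@le_trans _ _ (k / (d / 2))%:E); last by rewrite lee_fin lerDr.
apply: distortion_le => //; first exact: ltW.
  by move=> y z /locator_sub Ly /locator_sub Lz; exact: sepL.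
exact: cov1.
Qed.

End LinearRepetitivity.

(** * Frequencies *)

Section Counting.
Context {R : realType} {T : choiceType}.
Implicit Types (A B : set T) (s : seq T).

Lemma counting_ge_size A s : uniq s -> (forall x, x \in s -> A x) ->
  (((size s)%:R : R)%:E <= counting A)%E.
Proof.
move=> us sA; rewrite /counting; case: asboolP => [finA|_]; last exact: leey.
rewrite lee_fin ler_nat; apply: uniq_leq_size => // x xs.
by rewrite in_fset_set // inE; exact: sA.
Qed.

(** For an infinite set, where [counting] is [+oo], a sufficiently large finite subset is taken. *)
Lemma counting_witness A (r : R) : (r%:E <= counting A)%E ->
  exists s, [/\ uniq s, forall x, x \in s -> A x & r <= (size s)%:R].
Proof.
rewrite /counting; case: asboolP => [finA|infA] rA.
  exists (finmap.enum_fset (fset_set A)); split; [exact: finmap.fset_uniq| |exact: rA].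
  by move=> x; rewrite in_fset_set // inE.
have [B BA nB] := @infinite_set_fset _ A (Num.Def.archi_bound `|r|) infA.
exists (finmap.enum_fset B); split; [exact: finmap.fset_uniq|by move=> x /BA|].
apply: le_trans (ler_norm r) _; apply: le_trans (ltW (archi_boundP (normr_ge0 _))) _.
by rewrite ler_nat.
Qed.

Lemma le_counting A B : A `<=` B -> (counting A <= counting B :> \bar R)%E.
Proof.
move=> AB; rewrite {1}/counting; case: asboolP => [finA|infA].
  apply: counting_ge_size; first exact: finmap.fset_uniq.
  by move=> x; rewrite in_fset_set // inE => /AB.
rewrite /counting; case: asboolP => // finB.
by case: infA; exact: sub_finite_set finB.
Qed.

End Counting.

Section Frequency.
Context {R : realType} {N : nat}.
Local Notation E := 'rV[R]_N.
Variable Lam : set E.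
Implicit Types (P : E * R) (c : E * R) (x y z p v : E) (d A l k w : R).

Lemma leb_vol_ge0 (A : set E) : (0 <= leb_vol A)%E.
Proof.
apply: le_ereal_inf_tmp => _ [b [bb _] <-]; apply: nneseries_ge0 => k _ _.
by rewrite lee_fin prodr_ge0 // => i _; rewrite subr_ge0.
Qed.

Lemma leb_vol_cube_fin c : (0 < N)%N -> 0 < c.2 ->
  exists2 v, leb_vol (cube c) = v%:E & c.2 ^+ N <= v <= (3 * c.2) ^+ N.
Proof.
move=> N0 c0; have := leb_vol_cube_ge (ltW c0); have := leb_vol_cube_le N0 c0.
by case: (leb_vol _) => [v||] //; rewrite !lee_fin => vl vg; exists v; rewrite // vl vg.
Qed.

Lemma leb_vol_ball_fin y (r : R) : (0 < N)%N -> 0 < r ->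
  exists2 b, leb_vol (eucl_ball y r) = b%:E & (2 * (r / N%:R)) ^+ N <= b <= (4 * r) ^+ N.
Proof.
move=> N0 r0; have := leb_vol_ball_ge y N0 (ltW r0); have := leb_vol_ball_le y N0 r0.
by case: (leb_vol _) => [v||] //; rewrite !lee_fin => vl vg; exists v; rewrite // vl vg.
Qed.

(** The lower limit becomes a finite statement about all cubes of large side, with the cube's volume
    bounded below and the ball's volume above. *)
Lemma many_occurrences w P : (0 < N)%N -> 0 <= w -> 0 < P.2 -> (w%:E < nu Lam P)%E ->
  exists s0, forall c, s0 <= c.2 -> exists s : seq E,
    [/\ uniq s, forall y, y \in s -> locator_in Lam P (cube c) y &
        w * c.2 ^+ N <= (size s)%:R * (4 * P.2) ^+ N].
Proof.
move=> N0 w0 R0; rewrite /nu limf_einfE => /ereal_sup_gt[_ [V [M _ MV] <-] wV].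
(* A side at least 1 is at most its own [N]-th power, so such a cube has volume above [M]. *)
exists (`|M| + 1) => c sc; have M0 := normr_ge0 M.
have c0 : 0 < c.2 by lra.
have [v vE /andP[v_ge _]] := leb_vol_cube_fin N0 c0.
have [b bE /andP[b_ge b_le]] := leb_vol_ball_fin 0 N0 R0.
have cN : 0 < c.2 ^+ N by rewrite exprn_gt0.
have RN : 0 < (4 * P.2) ^+ N by rewrite exprn_gt0 // mulr_gt0.
have Vc : V c.
  apply: MV; split=> //; rewrite vE lte_fin; apply: lt_le_trans v_ge.
  apply: (@lt_le_trans _ _ c.2); first by have := ler_norm M; lra.
  by rewrite -{1}(expr1 c.2); apply: ler_weXn2l => //; lra.
have : (w%:E < npat Lam P (cube c) * leb_vol (eucl_ball (0%R : E) P.2) / leb_vol (cube c))%E.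
  by apply: (lt_le_trans wV); apply: ereal_inf_lbound; exists c.
have v0 : 0 < v by exact: lt_le_trans v_ge.
rewrite vE bE inve_gt0_fin // lte_pdivlMr //.
move=> wnp; have : ((w * c.2 ^+ N / (4 * P.2) ^+ N)%:E <= npat Lam P (cube c))%E.
  rewrite EFinM lee_pdivrMr //; apply: (@le_trans _ _ (npat Lam P (cube c) * b%:E)%E).
    apply: le_trans (ltW wnp); rewrite -EFinM lee_fin; exact: ler_wpM2l.
  apply: lee_wpmul2l; last by rewrite lee_fin.
  by apply: (@counting_ge_size R _ _ [::]).
move=> /counting_witness[s [us sP ws]]; exists s; split=> //.
by move: ws; rewrite ler_pdivrMr.
Qed.

Lemma nu'_le_nu P : (nu' Lam P <= nu Lam P)%E.
Proof.
rewrite /nu /nu' !limf_einfE; apply: ge_ereal_sup => _ [V FV <-].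
apply: le_trans (ereal_sup_ubound _); last by exists V.
apply: le_ereal_inf_tmp => _ [c Vc <-].
apply: le_trans (ereal_inf_lbound _) _; first by exists c.
apply: lee_wpmul2r; first by rewrite inve_ge0 leb_vol_ge0.
apply: lee_wpmul2r; first exact: leb_vol_ge0.
by apply: ge_ereal_sup => _ [A [AP _] <-]; exact: le_counting.
Qed.

Lemma positive_quasiweights_weights :
  positive_quasiweights Lam -> positive_weights Lam.
Proof.
move=> /lt_le_trans; apply; apply: le_ereal_inf_tmp => _ [P P1 <-].
by apply: le_trans (nu'_le_nu P); apply: ereal_inf_lbound; exists P.
Qed.

(* One point of the locator set near the centre of each cell of a grid of mesh
   (2 * k + 3) * P.2. *)
Lemma npat'_ge k P c (n : nat) : (0 < N)%N -> 0 < k -> linear_covering Lam k ->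
  ball_patterns_ge1 Lam P -> (2 * k + 3) * P.2 * n%:R <= c.2 ->
  (((n%:R : R) ^+ N)%:E <= npat' Lam P (cube c))%E.
Proof.
move=> N0 k0 cov P1; set D := (2 * k + 3) * P.2 => nc.
have R0 := P1.1.2.
have D0 : 0 < D by rewrite mulr_gt0 //; lra.
(* These are the centres of the grid cells. Moving each by at most [k * P.2] leaves distances of at
   least [3 * P.2] between the chosen points, and keeps the ball of radius [P.2] about each inside
   its cell. *)
pose p (m : {ffun 'I_N -> 'I_n}) := c.1 + \row_i (D * (m i)%:R + D / 2).
have near_p m : exists z, locator Lam P z /\ eucl_dist (p m) z <= k * P.2.
  by have [z] := cov P P1 (p m); exists z.
have [y yP] := choice near_p.
have sep m m' : m != m' -> 2 * P.2 < eucl_dist (y m) (y m').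
  move=> mm'; have [i mi] : exists i, m i != m' i.
    apply: contrapT => nm; case/negP: mm'; apply/eqP/ffunP => i.
    by apply/eqP; apply: contrapT => /negP mi; apply: nm; exists i.
  have Dp : D <= eucl_dist (p m) (p m').
    apply: le_trans (eucl_dist_coord _ _ i); rewrite !mxE.
    wlog : m m' mm' mi / (m i < m' i)%N => [H|].
      have := mi; rewrite neq_ltn => /orP[|] mi'; first exact: H.
      by rewrite distrC; apply: H => //; rewrite eq_sym.
    rewrite -(ler_nat R) -natr1 => lt; rewrite ler_normr; apply/orP; right; nra.
  have [_ pm] := yP m; have [_ pm'] := yP m'.
  have := eucl_dist_triangle (y m) (p m) (p m').
  have := eucl_dist_triangle (y m') (y m) (p m').
  by rewrite (eucl_distC (y m') (p m')); move: Dp; rewrite /D; lra.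
apply: (@le_trans _ _ (counting (range y))); last first.
  apply: ereal_sup_ubound; exists (range y) => //; split.
    move=> _ [m _ <-]; have [Py pm] := yP m; split=> // u yu i.
    have := eucl_dist_coord (p m) u i; have := eucl_dist_triangle (y m) (p m) u.
    have mn : (m i)%:R + 1 <= n%:R :> R by rewrite natr1 ler_nat.
    have m0 : 0 <= (m i)%:R :> R by [].
    have := ler_wpM2l (ltW D0) mn; have := mulr_ge0 (ltW D0) m0.
    have : eucl_dist (y m) u <= P.2 by [].
    have : D = 2 * (k * P.2) + 3 * P.2 by rewrite /D; ring.
    rewrite !mxE ler_norml; lra.
  move=> _ _ [m _ <-] [m' _ <-] yy; apply: sep.
  by apply/eqP => mm'; apply: yy; rewrite mm'.
have -> : (n%:R : R) ^+ N = (size [seq y m | m <- enum {ffun 'I_N -> 'I_n}])%:R.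
  by rewrite size_map -cardE card_ffun !card_ord natrX.
apply: counting_ge_size => [|_ /mapP[m _ ->]]; last by exists m.
rewrite map_inj_uniq ?enum_uniq // => m m' yy; apply/eqP; apply: contraTT isT.
by move=> /sep; rewrite yy eucl_distxx ltNge mulr_ge0 // ltW.
Qed.

Lemma nu'_ge k P : (0 < N)%N -> 0 < k -> linear_covering Lam k ->
  ball_patterns_ge1 Lam P ->
  (((3 * N%:R * (2 * k + 3))^-1 ^+ N)%:E <= nu' Lam P)%E.
Proof.
move=> N0 k0 cov P1; rewrite /nu' limf_einfE; set w := _^-1.
have R0 := P1.1.2.
set D := (2 * k + 3) * P.2; have D0 : 0 < D by rewrite mulr_gt0 //; lra.
have NR : 0 < N%:R :> R by rewrite ltr0n.
have w0 : 0 < w by rewrite invr_gt0 !mulr_gt0 //; lra.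
(* The threshold forces the side above [2 * D], so that [q > 2] and rounding [q] down loses at most
   a factor 2. *)
set V : set (E * R) := [set c | 0 < c.2 /\ (((3 * (2 * D)) ^+ N)%:E < leb_vol (cube c))%E].
apply: le_trans (ereal_sup_ubound _); last by exists V => //; exists ((3 * (2 * D)) ^+ N).
apply: le_ereal_inf_tmp => _ [c [c0 Mc] <-].
have [v vE /andP[v_ge v_le]] := leb_vol_cube_fin N0 c0.
have [b bE /andP[b_ge b_le]] := leb_vol_ball_fin 0 N0 R0.
have v0 : 0 < v by apply: lt_le_trans v_ge; rewrite exprn_gt0.
have cD : 2 * D < c.2.
  rewrite ltNge; apply/negP => cD; move: Mc; rewrite vE lte_fin ltNge.
  rewrite (le_trans v_le) //; apply: lerXn2r; rewrite ?nnegrE.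
  - by rewrite mulr_ge0 // ltW.
  - by apply: mulr_ge0 => //; apply: mulr_ge0 => //; exact: ltW.
  - by rewrite ler_wpM2l.
pose q := c.2 / D; have q0 : 0 <= q by rewrite divr_ge0 ?ltW.
have [nq qn] := andP (truncn_itv q0); set n := Num.truncn q in nq qn.
have qD : q * D = c.2 by rewrite /q mulfVK // gt_eqF.
have q2 : 2 < q by rewrite /q ltr_pdivlMr.
have npat_ge : (((n%:R : R) ^+ N)%:E <= npat' Lam P (cube c))%E.
  by apply: (npat'_ge (k := k)) => //; rewrite -/D -qD mulrC ler_wpM2r // ltW.
rewrite vE bE inve_gt0_fin // lee_pdivlMr //.
apply: (@le_trans _ _ ((n%:R : R) ^+ N * b)%:E); last first.
  rewrite EFinM; apply: lee_wpmul2r => //; rewrite lee_fin.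
  by apply: le_trans b_ge; rewrite exprn_ge0 // mulr_ge0 // divr_ge0 // ltW.
rewrite -EFinM lee_fin.
apply: (@le_trans _ _ (w ^+ N * (3 * c.2) ^+ N)).
  by rewrite ler_wpM2l // exprn_ge0 // ltW.
apply: (@le_trans _ _ (n%:R ^+ N * (2 * (P.2 / N%:R)) ^+ N)); last first.
  by rewrite ler_wpM2l // exprn_ge0.
rewrite -!exprMn ler_pXn2r // ?nnegrE; last 2 first.
- by rewrite !mulr_ge0 // ltW.
- by rewrite !mulr_ge0 // ?invr_ge0 ltW.
have -> : w * (3 * c.2) = q * (P.2 / N%:R).
  by rewrite /w /q /D; field; rewrite !gt_eqF //=; lra.
rewrite [leRHS]mulrA ler_wpM2r ?divr_ge0 ?(ltW R0) //.
by move: qn; rewrite -natr1; lra.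
Qed.

Lemma linearly_repetitive_quasiweights : (0 < N)%N ->
  linearly_repetitive Lam -> positive_quasiweights Lam.
Proof.
move=> N0 /linearly_repetitive_covering[k k0 cov].
apply: (@lt_le_trans _ _ ((3 * N%:R * (2 * k + 3))^-1 ^+ N)%:E).
  rewrite lte_fin exprn_gt0 // invr_gt0 !mulr_gt0 ?ltr0n //; lra.
by apply: le_ereal_inf_tmp => _ [P P1 <-]; exact: nu'_ge.
Qed.

End Frequency.

(** * Scales *)

Section Scales.
Context {R : realType} {N : nat}.
Local Notation E := 'rV[R]_N.
Implicit Types (P c : E * R) (x y z p v : E) (a d A l w : R) (G : set E).

(** Indexing by a list of arbitrary labels allows a point to carry the scale at which it was
    found. *)
Lemma packing_bound_seq (T : eqType) (s : seq T) (z : T -> E) (r : T -> R) c :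
  (0 < N)%N -> 0 <= c.2 -> uniq s ->
  {in s, forall t, 0 < r t <= c.2 /\ cube c (z t)} ->
  {in s &, forall t u, t != u -> r t + r u <= 2 * eucl_dist (z t) (z u)} ->
  \sum_(t <- s) (r t / N%:R) ^+ N <= (3 * c.2) ^+ N.
Proof.
move=> N0 c0 us zc sep; case: s us zc sep => [|t0 s'] us zc sep.
  by rewrite big_nil exprn_ge0 // mulr_ge0.
set s := t0 :: s' in us zc sep *.
rewrite (big_nth t0) big_mkord.
apply: (@packing_bound R N (size s) (fun j => z (nth t0 s j)) (fun j => r (nth t0 s j))) => //.
- by move=> j; have [] := zc _ (mem_nth t0 (ltn_ord j)).
- by move=> j; have [] := zc _ (mem_nth t0 (ltn_ord j)).
by move=> j j' jj'; apply: sep; rewrite ?mem_nth // nth_uniq.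
Qed.

Definition isolated G a y := forall z, G z -> y <> z -> a <= eucl_dist y z.

Definition crowded G a y := exists z, [/\ G z, y <> z & eucl_dist y z < a].

Lemma not_isolated G a y : ~ isolated G a y -> crowded G a y.
Proof.
move=> ni; apply: contrapT => nc; apply: ni => z Gz yz.
by rewrite leNgt; apply/negP => yza; apply: nc; exists z.
Qed.

(* Neighbouring cells of bounded distortion have comparable sizes, so no scale
   between that of a crowded point and that of an isolated one is skipped. *)
Lemma intermediate_scale G d A l a : (0 < N)%N -> 0 < d -> 1 <= l ->
  separated_by G d -> covering G A -> (distortion G <= l%:E)%E -> 0 < a ->
  (exists2 x, G x & crowded G a x) -> (exists2 y, G y & isolated G (l * a) y) ->
  exists y, [/\ G y, isolated G a y & crowded G (l * a) y].
Proof.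
move=> N0 d0 l1 sepG covG dist a0 [x Gx cx] [y Gy iy].
apply: contrapT => none.
(* If no intermediate point exists, the crowded points [X] and the isolated points [Y] exhaust
   [G]. *)
pose X := [set u | G u /\ crowded G a u]; pose Y := [set u | G u /\ isolated G (l * a) u].
have XY : X `|` Y = G.
  apply/seteqP; split=> [u [[]|[]]//|u Gu].
  have [iu|/not_isolated cu] := pselect (isolated G a u); last by left.
  have [iu'|/not_isolated cu] := pselect (isolated G (l * a) u); first by right.
  by case: none; exists u.
have sepXY : separated_by (X `|` Y) d by rewrite XY.
have [|| p [u [v [[Gu [u' [Gu' uu' uu'a]]] [Gv iv] puv Vp]]]] :=
  voronoi_common_point N0 d0 sepXY; [by exists x|by exists y|].
rewrite XY in Vp.
(* The point [p] is at distance less than [l * a / 2] from [u], and equally far from [v]. So [u] and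
   [v] are less than [l * a] apart, against the isolation of [v]. *)
have pu := voronoi_dist_le N0 d0 (le_trans ler01 l1) sepG covG dist Gu Gu' uu' Vp.
have [uv|/eqP uv] := eqVneq u v.
  by have := iv _ Gu'; rewrite -uv => /(_ uu'); nra.
have := iv _ Gu (not_eq_sym uv); have := eucl_dist_triangle p v u.
by rewrite (eucl_distC v p) -puv; nra.
Qed.

End Scales.

(** * From positive weights and uniform cells to linear repetitivity *)

Section Converse.
Context {R : realType} {N : nat}.
Local Notation E := 'rV[R]_N.
Variable Lam : set E.
Implicit Types (P c : E * R) (x y z p v : E) (a d A l w : R).

(** The patch of radius [P.2 + b] at [y] contains every patch of radius [P.2] centred within [b] of
    [y], so it determines the locator set of [P] near [y] up to distance [b]. *)
Lemma locator_locator P y z b : 0 <= P.2 -> 0 <= b ->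
  locator Lam P y -> locator Lam (y, P.2 + b) z ->
  forall v, eucl_dist 0 v <= b -> locator Lam P (v + y) <-> locator Lam P (v + z).
Proof.
move=> R0 b0 Py /locatorP[/= Lz yz] v vb.
have agree u : eucl_dist 0 u <= P.2 -> Lam (u + (v + z)) <-> Lam (u + (v + y)).
  move=> uP; rewrite !addrA; apply: yz.
  have := eucl_dist_triangle v 0 (u + v).
  by have := eucl_distDr 0 u v; rewrite add0r; lra.
have Lvz : Lam (v + z) <-> Lam (v + y) by apply: yz; lra.
split=> /locatorP[Lv H]; apply/locatorP; split; try exact/Lvz.
- by move=> u uP; rewrite (agree u uP); exact: H.
- by move=> u uP; rewrite -(agree u uP); exact: H.
Qed.

(** A point of the locator set too close to [z] would be visible in the larger pattern and could be
    copied back next to [y]. *)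
Lemma locator_isolated P y z a b : 0 <= P.2 -> a <= b -> 0 <= b ->
  locator Lam P y -> locator Lam (y, P.2 + b) z ->
  isolated (locator Lam P) a y -> isolated (locator Lam P) a z.
Proof.
move=> R0 ab b0 Py Qz iy u Pu zu; rewrite leNgt; apply/negP => zua.
have uzb : eucl_dist 0 (u - z) <= b by rewrite eucl_dist_sub0; lra.
have Pv : locator Lam P (u - z + y).
  by apply/(locator_locator R0 b0 Py Qz uzb); rewrite subrK.
have := iy _ Pv; have := eucl_distDr 0 (u - z) y; rewrite add0r => ->.
rewrite eucl_dist_sub0 leNgt zua /= => H.
have /H// : y <> u - z + y.
by move=> /esym/eqP; rewrite -subr_eq0 addrK subr_eq0 => /eqP/esym.
Qed.

Lemma locator_crowded P y z b : 0 <= P.2 -> 0 <= b ->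
  locator Lam P y -> locator Lam (y, P.2 + b) z ->
  crowded (locator Lam P) b y -> crowded (locator Lam P) b z.
Proof.
move=> R0 b0 Py Qz [u [Pu yu yub]].
have uyb : eucl_dist 0 (u - y) <= b by rewrite eucl_dist_sub0 ltW.
exists (u - y + z); split.
- by apply/(locator_locator R0 b0 Py Qz uyb); rewrite subrK.
- by move=> /esym/eqP; rewrite -subr_eq0 addrK subr_eq0 => /eqP/esym.
- by have := eucl_distDr 0 (u - y) z; rewrite add0r => ->; rewrite eucl_dist_sub0.
Qed.

Lemma locator_larger P y z b : 0 <= P.2 -> 0 <= b ->
  locator Lam P y -> locator Lam (y, P.2 + b) z -> locator Lam P z.
Proof.
move=> R0 b0 Py Qz; have := locator_locator R0 b0 Py Qz (v := 0).
by rewrite eucl_distxx !add0r => /(_ b0)[yz _]; exact: yz.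
Qed.

(** If all points of the locator set were isolated at this scale, the packing bound would allow
    fewer occurrences in a large cube than the weight [w] demands. *)
Lemma exists_crowded w P : (0 < N)%N -> 0 < w ->
  ball_patterns_ge1 Lam P -> (w%:E < nu Lam P)%E ->
  exists2 x, locator Lam P x &
    crowded (locator Lam P) (12 * N%:R * (1 + w^-1) * P.2) x.
Proof.
move=> N0 w0 P1 wP; have R0 := P1.1.2.
have NR : 0 < N%:R :> R by rewrite ltr0n.
have wi0 : 0 < w^-1 by rewrite invr_gt0.
set a := 12 * N%:R * (1 + w^-1) * P.2.
have a0 : 0 < a by rewrite !mulr_gt0 //; lra.
apply: contrapT => none.
have iso y : locator Lam P y -> isolated (locator Lam P) a y.
  by move=> Py; apply: contrapT => /not_isolated cy; apply: none; exists y.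
have [s0 many] := many_occurrences N0 (ltW w0) R0 wP.
pose t := `|s0| + a; have t0 : 0 < t by rewrite ltr_wpDl.
have [|s [us sP ws]] := many (0, t); first by rewrite /= /t; have := ler_norm s0; lra.
have := @packing_bound_seq R N _ s id (fun=> a) (0, t) N0 (ltW t0) us.
rewrite big_const_seq count_predT iter_addr_0 -(mulr_natl ((a / N%:R) ^+ N)) /=.
(* The factor 3 cancels the one in the packing bound, [4 * P.2] matches the ball volume, and
   [1 + w^-1] leaves [w * t ^+ N + t ^+ N <= t ^+ N], a contradiction. *)
have -> : a / N%:R = 4 * P.2 * (3 * (1 + w^-1)).
  by rewrite /a; field; rewrite !gt_eqF.
rewrite exprMn => H.
have tN : 0 < t ^+ N by rewrite exprn_gt0.
have {}H : (size s)%:R * (4 * P.2) ^+ N * (1 + w^-1) ^+ N <= t ^+ N.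
  rewrite -(@ler_pM2l _ (3 ^+ N)) ?exprn_gt0 // -[leRHS]exprMn; apply: le_trans (H _ _).
  - by rewrite [(3 * _) ^+ N]exprMn le_eqVlt; apply/orP; left; apply/eqP; ring.
  - move=> y ys; split; first by rewrite a0 /= /t lerDr.
    by apply: (sP y ys).2; rewrite /eucl_ball /= eucl_distxx ltW.
  - move=> y z ys zs /eqP yz; have := iso _ (sP y ys).1 _ (sP z zs).1 yz; lra.
have {}H : w * t ^+ N * (1 + w^-1) <= t ^+ N.
  apply: le_trans H; apply: ler_pM => //.
  - by rewrite mulr_ge0 // ltW.
  - by lra.
  - by rewrite -{1}(expr1 (1 + w^-1)); apply: ler_weXn2l => //; lra.
have : w * t ^+ N * (1 + w^-1) = w * t ^+ N + t ^+ N by field; rewrite gt_eqF.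
have : 0 < w * t ^+ N by rewrite mulr_gt0.
by lra.
Qed.

(** An uncovered point [p] lies in the cell of its nearest point [y]. Bounded distortion makes the
    cell of [y] that large only if all other points are far from [y]. *)
Lemma isolated_of_not_covering (G : set E) d A l r : (0 < N)%N -> 0 < d -> 0 < l ->
  separated_by G d -> covering G A -> (distortion G <= l%:E)%E ->
  ~ covering G (l * (r / 2)) -> exists2 y, G y & isolated G r y.
Proof.
move=> N0 d0 l0 sepG covG dist ncov.
have [p far] : exists p, forall y, G y -> l * (r / 2) < eucl_dist p y.
  apply: contrapT => near; apply: ncov => p; apply: contrapT => nop.
  apply: near; exists p => y Gy; rewrite ltNge; apply/negP => py; apply: nop.
  by exists y.
have G0 : G !=set0 by have [y Gy _] := covG p; exists y.
have [y [Gy yp]] := nearest_point p N0 d0 sepG G0.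
exists y => // z Gz yz.
have := voronoi_dist_le N0 d0 (ltW l0) sepG covG dist Gy Gz yz yp.
move=> /(lt_le_trans (far y Gy)); rewrite ltr_pM2l //; lra.
Qed.

(* The locator sets of the patterns (y k, P.2 + a k.+1) are pairwise disjoint
   subsets of the one of P, and each fills a proportion of space bounded below independently of k. *)
Lemma number_of_scales w l P (a : nat -> R) (K : nat) (y : nat -> E) :
  (0 < N)%N -> 0 < w -> 1 <= l ->
  (forall Q, ball_patterns_ge1 Lam Q -> (w%:E < nu Lam Q)%E) ->
  ball_patterns_ge1 Lam P -> P.2 <= a 0%N -> (forall k, a k.+1 = l * a k) ->
  (forall k, (k < K)%N -> [/\ locator Lam P (y k),
     isolated (locator Lam P) (a k) (y k) &
     crowded (locator Lam P) (a k.+1) (y k)]) ->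
  w * K%:R <= (12 * (1 + l) * N%:R) ^+ N.
Proof.
move=> N0 w0 l1 weight P1 Pa a_S yP.
have R0 := P1.1.2; have R1 := P1.2.
have NR : 0 < N%:R :> R by rewrite ltr0n.
have a_ge k : P.2 <= a k by elim: k => // k IH; rewrite a_S; nra.
have a_gt0 k : 0 < a k by exact: lt_le_trans (a_ge k).
have a_mono : {homo a : i j / (i <= j)%N >-> i <= j}.
  apply: homo_leq => [//|i j k|k]; first exact: le_trans.
  by rewrite a_S; have := a_gt0 k; nra.
have many k : exists s0, (k < K)%N -> forall c, s0 <= c.2 -> exists s : seq E,
    [/\ uniq s, forall z, z \in s -> locator_in Lam (y k, P.2 + a k.+1) (cube c) z &
        w * c.2 ^+ N <= (size s)%:R * (4 * (P.2 + a k.+1)) ^+ N].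
  have [kK|] := boolP (k < K)%N; last by exists 0.
  have [Py _ _] := yP k kK; have ak := a_gt0 k.+1.
  have Q0 : 0 < P.2 + a k.+1 by lra.
  have Q1 : ball_patterns_ge1 Lam (y k, P.2 + a k.+1).
    by split=> /=; [split=> //=; exact: locator_sub Py|lra].
  have [s0 s0P] := @many_occurrences R N Lam w (y k, P.2 + a k.+1) N0 (ltW w0) Q0
    (weight _ Q1).
  by exists s0.
have [s0 s0P] := choice many.
(* One cube serves all scales: its side exceeds every threshold and every [a k] with [k < K]. *)
pose t := \sum_(k < K) (`|s0 k| + a k) + 1.
have term0 k : 0 <= `|s0 k| + a k by rewrite addr_ge0 // ltW.
have t_ge k : (k < K)%N -> `|s0 k| + a k <= t.
  move=> kK; rewrite /t (bigD1 (Ordinal kK)) //= -addrA lerDl addr_ge0 //.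
  by apply: sumr_ge0 => j _; exact: term0.
have t0 : 0 < t by rewrite ltr_wpDl // sumr_ge0 // => j _; exact: term0.
have occ k : exists s : seq E, (k < K)%N -> [/\ uniq s,
    forall z, z \in s -> locator_in Lam (y k, P.2 + a k.+1) (cube (0, t)) z &
    w * t ^+ N <= (size s)%:R * (4 * (P.2 + a k.+1)) ^+ N].
  have [kK|] := boolP (k < K)%N; last by exists [::].
  have [|s sP] := s0P k kK (0, t); last by exists s.
  by have := t_ge k kK; have := ler_norm (s0 k); have := a_gt0 k; rewrite /=; lra.
have [S SP] := choice occ.
(* Each point is labelled with its scale; that scales share no point is proved afterwards. *)
pose L := [seq (k, z) | k <- iota 0 K, z <- S k].
have LP q : q \in L -> (q.1 < K)%N /\ q.2 \in S q.1.
  by move=> /allpairsPdep[k [z [+ zS ->]]]; rewrite mem_iota add0n.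
have facts q : q \in L -> [/\ (q.1 < K)%N, locator Lam P q.2,
    isolated (locator Lam P) (a q.1) q.2, crowded (locator Lam P) (a q.1.+1) q.2 &
    cube (0, t) q.2].
  move=> /LP[kK qS]; have [Py iy cy] := yP _ kK; have [_ SP' _] := SP _ kK.
  have [Qz Qt] := SP' _ qS; have aS := a_gt0 q.1.+1.
  split=> //.
  - exact: locator_larger (ltW R0) (ltW aS) Py Qz.
  - exact: locator_isolated (ltW R0) (a_mono _ _ (leqnSn _)) (ltW aS) Py Qz iy.
  - exact: locator_crowded (ltW R0) (ltW aS) Py Qz cy.
  - by apply: Qt; rewrite /eucl_ball /= eucl_distxx; lra.
have uL : uniq L.
  apply: allpairs_uniq_dep; first exact: iota_uniq.
    by move=> k; rewrite mem_iota => kK; have [] := SP k kK.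
  by move=> [k z] [k' z'] _ _ /= [-> ->].
have sepL : {in L &, forall q q', q != q' ->
    a q.1 + a q'.1 <= 2 * eucl_dist q.2 q'.2}.
  move=> q q' qL q'L qq'.
  wlog le_qq' : q q' qL q'L qq' / (q.1 <= q'.1)%N => [H|].
    have [le|/ltnW le] := leqP q.1 q'.1; first exact: H.
    by rewrite addrC eucl_distC; apply: H => //; rewrite eq_sym.
  have [_ Pq iq cq _] := facts _ qL; have [_ Pq' iq' _ _] := facts _ q'L.
  (* A point common to two scales would be crowded at [a q.1.+1] and isolated at [a q'.1], which is
     at least as large. *)
  have qz : q'.2 <> q.2.
    move=> qz; have [eq1|neq1] := eqVneq q.1 q'.1.
      by move: qq'; rewrite [q]surjective_pairing [q']surjective_pairing eq1 qz eqxx.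
    have lt_qq' : (q.1 < q'.1)%N by rewrite ltn_neqAle neq1.
    have [u [Pu qu qua]] := cq; have := iq' u Pu; rewrite qz => /(_ qu).
    by have := a_mono _ _ lt_qq'; lra.
  have := iq' _ Pq qz; have := a_mono _ _ le_qq'; rewrite eucl_distC; lra.
have := @packing_bound_seq R N _ L snd (fun q => a q.1) (0, t) N0 (ltW t0) uL _ sepL.
rewrite big_allpairs_dep /= => pack.
have tN : 0 < t ^+ N by rewrite exprn_gt0.
(* Since [P.2 <= a k], the radius [P.2 + a k.+1] is at most [(1 + l) * a k]. So each scale occupies
   at least [w * t ^+ N / b], whatever [k] is. *)
pose b := (4 * (1 + l) * N%:R) ^+ N.
have b0 : 0 < b by rewrite exprn_gt0 // !mulr_gt0 //; lra.
have term k : k \in iota 0 K -> w * t ^+ N / b <= \sum_(z <- S k) (a k / N%:R) ^+ N.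
  rewrite mem_iota => kK; have [_ _ wS] := SP k kK.
  rewrite big_const_seq count_predT iter_addr_0 -(mulr_natl ((a k / N%:R) ^+ N)).
  rewrite ler_pdivrMr // -mulrA -exprMn; apply: le_trans wS _.
  rewrite ler_wpM2l // lerXn2r // ?nnegrE.
  - by have := a_gt0 k.+1; lra.
  - by rewrite !mulr_ge0 // ?invr_ge0 ?(ltW (a_gt0 k)) //; lra.
  have -> : a k / N%:R * (4 * (1 + l) * N%:R) = 4 * (a k + l * a k).
    by field; rewrite gt_eqF.
  by rewrite a_S; have := a_ge k; lra.
have : K%:R * (w * t ^+ N / b) <= (3 * t) ^+ N.
  apply: le_trans (pack _).
    rewrite big_seq; apply: le_trans (ler_sum _ term).
    by rewrite -big_seq big_const_seq count_predT size_iota iter_addr_0 mulr_natl.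
  move=> q qL; have [kK _ _ _ qt] := facts q qL; split=> //.
  by rewrite a_gt0 /=; have := t_ge _ kK; have := normr_ge0 (s0 q.1); lra.
rewrite (_ : _ * _ = w * K%:R / b * t ^+ N); last by ring.
rewrite exprMn ler_pM2r // ler_pdivrMr // -exprMn.
by rewrite (_ : 3 * _ = 12 * (1 + l) * N%:R) //; ring.
Qed.

Lemma positive_weights_linearly_repetitive : (0 < N)%N -> delone Lam ->
  positive_weights Lam -> uniform_cells Lam -> linearly_repetitive Lam.
Proof.
move=> N0 [/r_pack_separated[d d0 sepL] _] pw [rep uc].
have [w w0 weight] : exists2 w : R, 0 < w &
    forall Q, ball_patterns_ge1 Lam Q -> (w%:E < nu Lam Q)%E.
  have [w /andP[w0 wi]] : exists w : R, ((0%:E < w%:E) && (w%:E < ereal_inf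
      [set nu Lam Q | Q in ball_patterns_ge1 Lam]))%E.
    move: pw; rewrite /positive_weights; case: (ereal_inf _) => [e||] //.
      by rewrite lte_fin => e0; exists (e / 2); rewrite !lte_fin; lra.
    by exists 1; rewrite lte_fin ltr01 ltry.
  exists w => // Q Q1; apply: (lt_le_trans wi).
  by apply: ereal_inf_lbound; exists Q.
have [l l2 dist] : exists2 l : R, 2 <= l &
    forall Q, ball_patterns Lam Q -> (distortion (locator Lam Q) <= l%:E)%E.
  move: uc; set s := ereal_sup _ => s_fin.
  have [l sl] : exists l : R, (s <= l%:E)%E.
    by case: s s_fin => [e||] // _; [exists e|exists 0; rewrite leNye].
  exists (`|l| + 2) => [|Q Q0]; first by rewrite lerDr.
  apply: (@le_trans _ _ s); first by apply: ereal_sup_ubound; exists Q.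
  by apply: le_trans sl _; rewrite lee_fin; have := ler_norm l; lra.
have NR : 0 < N%:R :> R by rewrite ltr0n.
have wi0 : 0 < w^-1 by rewrite invr_gt0.
set M := (12 * (1 + l) * N%:R) ^+ N.
have M0 : 0 <= M by rewrite exprn_ge0 // !mulr_ge0 //; lra.
(* This is one scale count too many for [number_of_scales], and it does not depend on [P]. *)
pose K := Num.Def.archi_bound (M / w).
have MK : M < w * K%:R.
  by rewrite mulrC -ltr_pdivrMr // archi_boundP // divr_ge0 // ltW.
set C := 12 * N%:R * (1 + w^-1).
have C1 : 1 <= C.
  have : 1 <= N%:R :> R by rewrite ler1n.
  by rewrite /C; nra.
(* The constant is chosen so that failure of the covering at [l * (a K / 2)] produces a point
   isolated at [a K], while [exists_crowded] gives a point crowded at [a 0]. *)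
apply: (@covering_linearly_repetitive _ _ _ (l * (l ^+ K * C / 2))) => P P1.
have R0 := P1.1.2; set G := locator Lam P.
pose a k := l ^+ k * (C * P.2).
have a_gt0 k : 0 < a k by rewrite !mulr_gt0 ?exprn_gt0 //; lra.
have aS k : a k.+1 = l * a k by rewrite /a exprS mulrA.
have sepG : separated_by G d by move=> u v /locator_sub Lu /locator_sub; exact: sepL.
have [A covG] := relatively_dense_covering (rep P P1.1).
have distG := dist P P1.1.
have -> : l * (l ^+ K * C / 2) * P.2 = l * (a K / 2) by rewrite /a; ring.
apply: contrapT => ncov.
have [|z Gz iz] := isolated_of_not_covering N0 d0 _ sepG covG distG ncov; first by lra.
have [x Gx cx] := exists_crowded N0 w0 P1 (weight P P1).
have a_mono : {homo a : i j / (i <= j)%N >-> i <= j}.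
  apply: homo_leq => [//|i j k|k]; first exact: le_trans.
  by rewrite aS; have := a_gt0 k; nra.
(* The crowded point stays crowded at every larger scale and the isolated one isolated at every
   smaller scale, so each [k < K] has an intermediate point. *)
have scale k : exists u, (k < K)%N -> [/\ G u, isolated G (a k) u & crowded G (a k.+1) u].
  have [kK|] := boolP (k < K)%N; last by exists 0.
  have l1 : 1 <= l by lra.
  have [||u uP] := intermediate_scale N0 d0 l1 sepG covG distG (a_gt0 k).
  - exists x => //; have [v [Gv xv xva]] := cx; exists v; split=> //.
    apply: (lt_le_trans xva); apply: le_trans (a_mono 0%N k _) => //.
    by rewrite /a expr0 mul1r.
  - exists z => // v Gv zv; rewrite -aS; apply: le_trans (iz v Gv zv).
    exact: a_mono.
  - by exists u => _; rewrite aS.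
have [u uP] := choice scale.
have l1 : 1 <= l by lra.
have Pa : P.2 <= a 0%N by rewrite /a expr0 mul1r ler_peMl // ltW.
by have := number_of_scales N0 w0 l1 weight P1 Pa aS uP; rewrite -/M leNgt MK.
Qed.

End Converse.

Theorem theorem2p6 (R : realType) (N : nat) (Lam : set 'rV[R]_N) :
  (0 < N)%N -> delone Lam -> nonperiodic Lam ->
  [<-> linearly_repetitive Lam;
       positive_quasiweights Lam /\ uniform_cells Lam;
       positive_weights Lam /\ uniform_cells Lam].
Proof.
move=> N0 del nonper; tfae.
- move=> lr; split; first exact: linearly_repetitive_quasiweights lr.
  exact: linearly_repetitive_uniform_cells lr.
- move=> [pq u]; split; last exact: u.
  exact: positive_quasiweights_weights pq.
- move=> [pw u].
  exact: positive_weights_linearly_repetitive N0 del pw u.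
Qed.
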